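(* For every $T\in\mathcal T_h$, a function $\boldsymbol v\in\boldsymbol V(T)$ is uniquely determined by the values $\boldsymbol v(a)$ for all $a\in\mathcal N_T$ (that is, these values form a unisolvent set of degrees of freedom for $\boldsymbol V(T)$).
   Context: $\mathcal T_h$ is an isoparametric mesh whose elements are $T=F_T(\hat T)$, where $\hat T$ is the reference triangle with vertices $(1,0),(0,1),(0,0)$ and $F_T:\hat T\to T$ is a quadratic diffeomorphism with $c_1h_T^2\le\det(DF_T)\le c_2h_T^2$ for positive constants $c_1,c_2$ and $h_T>0$ the local mesh size. $\hat T^{ct}$ is the Clough–Tocher split of $\hat T$ into three triangles obtained by joining the vertices to the barycenter; $\hat{\boldsymbol V}=\{\hat{\boldsymbol v}\in [H^1(\hat T)]^2:\hat{\boldsymbol v}|_{\hat K}\in[\mathcal P_2(\hat K)]^2\ \forall\hat K\in\hat T^{ct}\}$ ($\mathcal P_k$: polynomials of degree $\le k$). With $A_T=DF_T/\det(DF_T)$ and $x=F_T(\hat x)$, $\boldsymbol V(T)=\{\boldsymbol v\in[H^1(T)]^2:\boldsymbol v(x)=A_T(\hat x)\hat{\boldsymbol v}(\hat x),\ \hat{\boldsymbol v}\in\hat{\boldsymbol V}\}$. $\mathcal N_{\hat T}$ is the set of the 4 vertices and 6 edge midpoints of $\hat T^{ct}$ and $\mathcal N_T=F_T(\mathcal N_{\hat T})$. *)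

(* Defs.v *)
From HB Require Import structures.
From mathcomp Require Import all_boot all_order all_algebra.
From mathcomp Require Import all_classical all_reals all_analysis.
Set Implicit Arguments.
Unset Strict Implicit.
Unset Printing Implicit Defensive.
Import Order.TTheory GRing.Theory Num.Theory.
Import numFieldNormedType.Exports.
Local Open Scope classical_set_scope.
Local Open Scope ring_scope.

(* Points of the plane are pairs, so that the product Lebesgue measure is
   available; vector values are columns, so that matrices act on them. *)
Notation pt R := (R * R)%type.

Section Calculus.
Context {R : realType}.
Implicit Types (U D : set (pt R)) (f u g : pt R -> R).

Definition area :
    {measure set (measurableTypeR R * measurableTypeR R)%type -> \bar R} :=
  (@lebesgue_measure R \x @lebesgue_measure R)%E.

Definition edir (j : 'I_2) : pt R := if j == 0 then (1, 0) else (0, 1).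

Definition coor (i : 'I_2) (x : pt R) : R := if i == 0 then x.1 else x.2.

Fixpoint Ck (k : nat) U f : Prop :=
  if k is k'.+1 then
    forall j : 'I_2,
      (forall x, U x -> derivable f x (edir j)) /\ Ck k' U ('D_(edir j) f)
  else forall x, U x -> {for x, continuous f}.

Definition test_function U (phi : pt R -> R) : Prop :=
  (forall k, Ck k setT phi) /\
  exists K, [/\ compact K, K `<=` U & forall x, ~ K x -> phi x = 0].

Definition L2 U u : Prop :=
  measurable_fun (U : set (measurableTypeR R * measurableTypeR R)) u /\
  (\int[area]_(x in U) ((`|u x| ^+ 2)%:E) < +oo)%E.

Definition weak_partial U (j : 'I_2) u g : Prop :=
  forall phi, test_function U phi ->
    \int[area]_(x in U) (u x * 'D_(edir j) phi x) =
    - \int[area]_(x in U) (g x * phi x).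

(* H^1(D) is H^1 of the interior of D; its elements are represented by
   functions, two of which are identified when they agree almost everywhere *)
Definition H1 D u : Prop :=
  L2 D° u /\ forall j, exists2 g, L2 D° g & weak_partial D° j u g.

Definition H1vec D (v : pt R -> 'cV[R]_2) : Prop :=
  forall i, H1 D (fun x => v x i 0).

Definition ae_eq_on D (v w : pt R -> 'cV[R]_2) : Prop :=
  {ae area, forall x, D x -> v x = w x}.

(* y is the value at a of the continuous representative of v on D *)
Definition value_at D (v : pt R -> 'cV[R]_2) (a : pt R) (y : 'cV[R]_2) : Prop :=
  exists w : pt R -> 'cV[R]_2,
    [/\ {within D, continuous w}, ae_eq_on D v w & w a = y].

(* f is a polynomial function of total degree at most k *)
Definition Pk (k : nat) f : Prop :=
  exists c : nat -> nat -> R, forall x : pt R,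
    f x = \sum_(i < k.+1) \sum_(j < k.+1 | (i + j <= k)%N)
            c i j * x.1 ^+ i * x.2 ^+ j.

Definition jac (F : pt R -> pt R) (x : pt R) : 'M[R]_2 :=
  \matrix_(i, j) 'D_(edir j) (fun y => coor i (F y)) x.

Definition piola (F : pt R -> pt R) (x : pt R) : 'M[R]_2 :=
  (\det (jac F x))^-1 *: jac F x.

Definition quadratic_map (F : pt R -> pt R) : Prop :=
  forall i, Pk 2 (fun x => coor i (F x)).

(* C^1 on the closed set F @` D is understood as C^1 on a neighbourhood *)
Definition diffeo_on D (F : pt R -> pt R) : Prop :=
  (exists U, [/\ open U, D `<=` U & forall i, Ck 1 U (fun x => coor i (F x))]) /\
  exists G : pt R -> pt R,
    (forall x, D x -> G (F x) = x) /\
    exists U, [/\ open U, F @` D `<=` U & forall i, Ck 1 U (fun x => coor i (G x))].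

End Calculus.

Section CloughTocher.
Context {R : realType}.

Definition triangle (a b c : pt R) : set (pt R) :=
  [set x | exists s t r : R,
     [/\ 0 <= s, 0 <= t, 0 <= r, s + t + r = 1 & x = s *: a + t *: b + r *: c]].

Definition ref_vertex (i : 'I_3) : pt R :=
  tnth [tuple (1, 0); (0, 1); (0, 0)] i.

Definition barycenter : pt R := 3^-1 *: \sum_(i < 3) ref_vertex i.

Definition ref_triangle : set (pt R) :=
  triangle (ref_vertex 0) (ref_vertex 1) (ref_vertex 2).

Definition ct_split : set (set (pt R)) :=
  [set K | exists i j : 'I_3,
     (i < j)%N /\ K = triangle (ref_vertex i) (ref_vertex j) barycenter].

Definition ct_vertices : set (pt R) := range ref_vertex `|` [set barycenter].

(* any two of the four vertices of the split are joined by one of its edges *)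
Definition ct_midpoints : set (pt R) :=
  [set m | exists a b : pt R,
     [/\ ct_vertices a, ct_vertices b, a <> b & m = 2^-1 *: (a + b)]].

Definition ref_nodes : set (pt R) := ct_vertices `|` ct_midpoints.

(* The polynomial condition is imposed on the interiors of the subtriangles
   only: with closed subtriangles the common values on the shared edges would
   already force continuity, whereas here it comes from H^1. *)
Definition Vhat : set (pt R -> 'cV[R]_2) :=
  [set v | H1vec ref_triangle v /\
     forall K, ct_split K -> forall i : 'I_2,
       exists2 p, Pk 2 p & forall x, K° x -> v x i 0 = p x].

End CloughTocher.

Record iso_mesh (R : realType) := IsoMesh {
  elt : finType;
  Fmap : elt -> pt R -> pt R;
  hsize : elt -> R;
  c1 : R;
  c2 : R;
  c1_gt0 : 0 < c1;
  c2_gt0 : 0 < c2;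
  hsize_gt0 : forall T, 0 < hsize T;
  Fmap_quadratic : forall T, quadratic_map (Fmap T);
  Fmap_diffeo : forall T, diffeo_on ref_triangle (Fmap T);
  Fmap_det : forall T x, ref_triangle x ->
    c1 * hsize T ^+ 2 <= \det (jac (Fmap T) x) <= c2 * hsize T ^+ 2
}.

Section Elements.
Context {R : realType} {M : iso_mesh R}.
Implicit Type T : elt M.

Definition element T : set (pt R) := Fmap T @` ref_triangle.

Definition nodes T : set (pt R) := Fmap T @` ref_nodes.

Definition VT T : set (pt R -> 'cV[R]_2) :=
  [set v | H1vec (element T) v /\
     exists2 vh, Vhat vh &
       {ae area, forall x, element T x -> forall xh, ref_triangle xh ->
          x = Fmap T xh -> v x = piola (Fmap T) xh *m vh xh}].

End Elements.

(* Main.v *)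
Require Import Defs.
From HB Require Import structures.
From mathcomp Require Import all_boot all_order all_algebra.
From mathcomp Require Import zify ring lra.
From mathcomp Require Import all_classical all_reals all_analysis measurable_realfun.
Set Implicit Arguments.
Unset Strict Implicit.
Unset Printing Implicit Defensive.
Import Order.TTheory GRing.Theory Num.Theory.
Import numFieldNormedType.Exports.
Local Open Scope classical_set_scope.
Local Open Scope ring_scope.

Notation mplane R := (measurableTypeR R * measurableTypeR R)%type.

(** A member of Vhat is a P2 polynomial on the interior of each subtriangle. Its
    weak derivative in x has no singular part, so the polynomials of two
    neighbouring subtriangles agree on the common edge: no edge of the split
    through the barycenter is horizontal, and testing with bumps that
    concentrate on the edge isolates the jump. Hence every member of Vhat is,
    up to a null set, the continuous piecewise P2 Lagrange interpolant of its
    values at the ten nodes. Conversely, such interpolants, and their images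
    under the Piola map of an element, are Lipschitz, hence in H^1: the
    integral of a directional derivative of a compactly supported Lipschitz
    function vanishes, by dominated convergence and translation invariance of
    the area. The Piola matrix is invertible, so the nodal values on the
    element and on the reference triangle determine each other. Finally the
    continuous representative is unique since the element is the closure of
    its interior (open mapping for the quadratic map F). *)

(** A member of [Vhat] or of [VT] is only a class modulo null sets, and its polynomial pieces are
    given on open subtriangles only, so its values on the edges say nothing. A nodal value is a
    value of a continuous representative, whose existence and uniqueness both have to be proved;
    this is why evaluation is a relation. One identity, that a derivative of a compactly supported
    Lipschitz function integrates to zero, serves in both directions: for a product with a test
    function it yields weak derivatives, and for a product corrected by a ramp it computes the jump
    across an edge. No trace or divergence theorem is involved. To be Lipschitz at sight, the
    interpolant is one formula on the whole plane, built from the barycentric coordinates and their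
    minimum. Test functions are drawn from an inductive class closed under differentiation and under
    composition with e^(-1/s). Density of the interior of an element enters because an almost
    everywhere equality says nothing at a single node. *)

(** * Borel sets of the plane and the product sigma-algebra *)

Section Measurability.
Context {R : realType}.
Implicit Types (U : set (pt R)) (f : pt R -> R).

(** The product sigma-algebra is generated by rectangles, so U is written as the union of the
    squares with rational centre and radius 1/(n+1) that it contains. Squares not contained in U are
    replaced by the empty set, which keeps the index set countable. *)
Lemma measurable_open U : open U -> measurable (U : set (mplane R)).
Proof.
move=> oU.
pose B (q : rat * rat) (n : nat) : set (mplane R) :=
  ball (ratr q.1 : R) (n.+1%:R^-1) `*` ball (ratr q.2 : R) (n.+1%:R^-1).
pose V (i : rat * rat * nat) : set (mplane R) :=
  if `[< B i.1 i.2 `<=` U >] then B i.1 i.2 else set0.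
have mV i : measurable (V i).
  rewrite /V; case: ifP => _ //.
  by apply: measurableX; exact: measurable_ball.
suff -> : U = \bigcup_i V i by apply: countable_bigcupT_measurable.
rewrite eqEsubset; split => [[x y] Uz|z [i _]]; last first.
  by rewrite /V; case: ifP => // /asboolP; apply.
have /nbhs_ballP[e/= e0 he] := open_nbhs_nbhs (conj oU Uz).
have [n hn] : exists n : nat, n.+1%:R^-1 < e / 2.
  have /ltr_add_invr[n] : 0 < e / 2 by lra.
  by rewrite add0r; exists n.
have n0 : 0 < n.+1%:R^-1 :> R by rewrite invr_gt0.
have rat_in (d t : R) : 0 < d -> exists q : rat, `|ratr q - t| < d.
  move=> d0; have [q] : exists q, ratr q \in `]t - d, t + d[.
    by apply: rat_in_itvoo; lra.
  by rewrite in_itv/= => /andP[? ?]; exists q; rewrite ltr_distl; apply/andP.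
have [p hp] := rat_in _ x n0; have [q hq] := rat_in _ y n0.
exists (p, q, n) => //; rewrite /V; case: ifP => [_|/asboolP]; first by split.
case; rewrite /B; move: (n.+1%:R^-1 : R) hn hp hq => d hn hp hq [x' y'] [/= hx hy]; apply: he; split => /=.
  apply: le_lt_trans (ler_distD (ratr p) _ _) _.
  move: hx; rewrite (distrC x) /ball/=. lra.
apply: le_lt_trans (ler_distD (ratr q) _ _) _.
by move: hy; rewrite (distrC y) /ball/=; lra.
Qed.

Lemma measurable_fun_open U f : open U ->
  {in U, continuous f} -> measurable_fun (U : set (mplane R)) f.
Proof.
move=> oU cf.
apply: (measurability _ (RGenOpens.measurableE R)).
move=> _ [_ [a [b ->] <-]].
apply: measurable_open.
rewrite openE => z [Uz Vz]; apply: filterI; first exact: (open_nbhs_nbhs (conj oU Uz)).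
apply: (cf z); first by rewrite inE.
exact: near_in_itvoo.
Qed.

Lemma measurable_fun_continuous f :
  continuous f -> measurable_fun (setT : set (mplane R)) f.
Proof.
by move=> cf; apply: measurable_fun_open => [|x _]; [exact: openT|exact: cf].
Qed.

End Measurability.

(** * Translation invariance of the area *)

Section AreaShift.
Context {R : realType}.
Implicit Types (h : pt R).

Lemma lebesgue_measure_translate (a : R) (A : set (measurableTypeR R)) :
  measurable A ->
  @lebesgue_measure R ((fun x => x + a) @^-1` A) = lebesgue_measure A.
Proof.
move=> mA; pose s : measurableTypeR R -> measurableTypeR R := fun x => x + a.
have ms : measurable_fun setT s by apply: measurable_funD.
apply/esym.
apply: (@lebesgue_measure_unique R (pushforward lebesgue_measure s)) => // _ [[b c]] _ <-; rewrite /pushforward.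
rewrite [X in _ = lebesgue_measure X](_ : _ = `](b - a), (c - a)]%classic).
  2: by apply/seteqP; split=> x; rewrite /s /= !in_itv/= ltrBlDr lerBrDr.
rewrite /= !lebesgue_measure_itv/= !lte_fin ltrD2r -!EFinB.
by case: ifP => // _; congr EFin; ring.
Qed.

Definition translate h (z : mplane R) : mplane R := (z.1 + h.1, z.2 + h.2).

Lemma measurable_translate h : measurable_fun setT (translate h).
Proof.
apply/measurable_fun_pairP; split.
  by apply: measurable_funD => //; exact: measurable_fst.
by apply: measurable_funD => //; exact: measurable_snd.
Qed.

(** A product measure is determined by its values on rectangles, where the claim is the
    one-dimensional invariance in each factor. *)
Lemma area_translate h (A : set (mplane R)) :
  measurable A -> area (translate h @^-1` A) = area A.
Proof.
move=> mA; apply/esym.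
apply: (product_measure_unique (m' := pushforward area (translate h))) => //.
  exact: measurable_translate.
move=> mh B C mB mC.
rewrite /pushforward.
have m a (D : set (measurableTypeR R)) : measurable D ->
    measurable ((fun x : measurableTypeR R => x + a) @^-1` D : set (measurableTypeR R)).
  move=> mD; rewrite -[X in measurable X]setTI.
  by apply: (measurable_funD _ _ measurableT mD).
have q := product_measure1E (@lebesgue_measure R) (@lebesgue_measure R)
  (m h.1 _ mB) (m h.2 _ mC).
apply: etrans q _.
by congr (_ * _)%E; exact: lebesgue_measure_translate.
Qed.

Lemma integral_translate h (f : mplane R -> \bar R) :
  area.-integrable setT f ->
  (\int[area]_z f (translate h z) = \int[area]_z f z)%E.
Proof.
move=> /[dup] /measurable_int mf fi.
have pE (g : mplane R -> \bar R) :
    (\int[pushforward area (translate h)]_z g z = \int[area]_z g z)%E.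
  apply: eq_measure_integral => //= [|mh A mA _]; first exact: measurable_translate.
  exact: area_translate.
have mfs : measurable_fun setT (f \o translate h).
  exact: measurableT_comp mf (measurable_translate h).
rewrite -[RHS]pE integral_pushforward//; first exact: measurable_translate.
apply/integrableP; split; first exact: mfs.
move/integrableP : fi => [_]; apply: le_lt_trans.
rewrite -[leRHS]pE ge0_integral_pushforward//; first exact: measurable_translate.
exact: measurableT_comp.
Qed.

End AreaShift.

(** * Lipschitz curves are null sets *)

Section NullCurves.
Context {R : realType}.
Implicit Types (g : R -> pt R).

Definition box (c : pt R) (r : R) : set (mplane R) :=
  `[c.1 - r, c.1 + r] `*` `[c.2 - r, c.2 + r].

Lemma measurable_box c r : measurable (box c r).
Proof. by apply: measurableX; exact: measurable_itv. Qed.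

Lemma area_box c r : 0 < r -> area (box c r) = ((2 * r) ^+ 2)%:E.
Proof.
move=> r0; have q x : @lebesgue_measure R `[x - r, x + r] = (2 * r)%:E.
  rewrite lebesgue_measure_itv/= lte_fin ifT; last by rewrite ltrD2l; lra.
  by rewrite -EFinB; congr EFin; ring.
have /= := product_measure1E (@lebesgue_measure R) (@lebesgue_measure R)
  (measurable_itv `[c.1 - r, c.1 + r]) (measurable_itv `[c.2 - r, c.2 + r]).
move=> E; apply: (etrans E); rewrite expr2 EFinM; congr (_ * _)%E; exact: q.
Qed.

(** The curve is covered by n+2 squares of half-side L/(n+1) centred at the points g(k/(n+1)). Since
    n+2 <= 2(n+1), their total area is at most 8 L^2/(n+1). *)
Lemma negligible_curve g (L : R) : 0 < L ->
  (forall s t, 0 <= s <= 1 -> 0 <= t <= 1 -> `|g s - g t| <= L * `|s - t|) ->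
  area.-negligible (g @` `[0, 1]).
Proof.
move=> L0 gL.
pose C (n : nat) : set (mplane R) :=
  \big[setU/set0]_(k < n.+2) box (g (k%:R / n.+1%:R)) (L / n.+1%:R).
have mC n : measurable (C n).
  by apply: bigsetU_measurable => k _; exact: measurable_box.
have n0 n : 0 < n.+1%:R :> R by rewrite ltr0n.
have aC n : (area (C n) <= (8 * L ^+ 2 / n.+1%:R)%:E)%E.
  apply: le_trans.
    by apply: (le_mu_bigsetU area (A := fun k => box (g (k%:R / n.+1%:R)) (L / n.+1%:R)))
       => k _; exact: measurable_box.
  rewrite (eq_bigr (fun=> ((2 * (L / n.+1%:R)) ^+ 2)%:E)); last first.
    by move=> k _; apply: area_box; rewrite divr_gt0.
  rewrite sumEFin lee_fin sumr_const card_ord -[leLHS]mulr_natl.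
  have -> : 8 * L ^+ 2 / n.+1%:R =
     (2 * n.+1%:R) * (2 * (L / n.+1%:R)) ^+ 2 :> R by field; rewrite gt_eqF.
  rewrite ler_wpM2r ?sqr_ge0//.
  by rewrite -(natrM _ 2%N) ler_nat; lia.
exists (\bigcap_n C n); split.
- exact: bigcapT_measurable.
- apply/eqP; rewrite eq_le measure_ge0 andbT.
  apply/lee_addgt0Pr => e e0; rewrite add0e.
  have [n hn] : exists n : nat, 8 * L ^+ 2 / n.+1%:R < e.
    have h : 0 < e / (8 * L ^+ 2) by rewrite divr_gt0// mulr_gt0// exprn_gt0.
    have [n] := ltr_add_invr h; rewrite add0r => hn; exists n.
    by rewrite mulrC -ltr_pdivlMr// mulr_gt0// exprn_gt0.
  apply: (@le_trans _ _ (8 * L ^+ 2 / n.+1%:R)%:E); last by rewrite lee_fin ltW.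
  apply: le_trans (aC n); apply: le_measure; rewrite ?inE//.
    exact: bigcapT_measurable.
  by move=> z; apply.
- move=> _ [t /= t01 <-] n _; rewrite /C.
  move: t01; rewrite in_itv/= => /andP[t0 t1].
  have tn0 : 0 <= t * n.+1%:R by rewrite mulr_ge0// ltW.
  have /andP[k1 k2] := truncn_itv tn0.
  set k := Num.trunc _ in k1 k2.
  (* The index k = n+1 occurs when t = 1, which is why n+2 squares are taken. *)
  have kn : (k < n.+2)%N.
    rewrite ltnS -(ler_nat R) (le_trans k1)//.
    by rewrite -[leRHS]mul1r ler_wpM2r// ltW.
  rewrite -(bigcup_mkord _ (fun k => box (g (k%:R / n.+1%:R)) (L / n.+1%:R))).
  exists k => //.
  have kt : k%:R / n.+1%:R <= t by rewrite ler_pdivrMr.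
  have tk : t - k%:R / n.+1%:R <= n.+1%:R^-1.
    rewrite lerBlDr -[X in X + _]mul1r -mulrDl ler_pdivlMr// nat1r.
    exact: ltW.
  have : `|g t - g (k%:R / n.+1%:R)| <= L / n.+1%:R.
    apply: le_trans (gL _ _ _ _) _; rewrite ?t0 ?t1//.
      by rewrite divr_ge0//= (le_trans kt).
    by apply: ler_wpM2l; [exact: ltW|rewrite ger0_norm ?subr_ge0].
  rewrite /Num.norm/= ge_max /box /= !in_itv/= => /andP[].
  by rewrite !ler_distl => /andP[-> ->] /andP[-> ->].
Qed.

End NullCurves.

(** * Locally Lipschitz functions and uniform constants on compact sets *)

Section LocallyLipschitz.
Context {R : realType}.
Implicit Types (f g : pt R -> R) (z : pt R).

(** Both points vary in the ball. A bound on one ball holds on all smaller ones, so quantifying over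
    all small radii costs nothing and lets finitely many such conditions be combined by [near]. *)
Definition loclip f z := exists K : R, \forall e \near (0 : R)^'+,
  forall x y, ball z e x -> ball z e y -> `|f x - f y| <= K * `|x - y|.

Lemma near_ball z (P : pt R -> Prop) : (\forall x \near z, P x) ->
  \forall e \near (0 : R)^'+, forall x, ball z e x -> P x.
Proof.
move=> /nbhs_ballP[d /= d0 dP]; near=> e => x zx; apply: dP.
by apply: le_ball zx; near: e; exact: nbhs_right_le.
Unshelve. all: by end_near. Qed.

Lemma prod_norm_ge (x : pt R) : `|x.1| <= `|x| /\ `|x.2| <= `|x|.
Proof. by rewrite [`|x|]/Num.norm/= !le_max !lexx/= orbT. Qed.

Lemma near_at_right (P : R -> Prop) : (\forall e \near (0 : R)^'+, P e) ->
  exists2 e, 0 < e & P e.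
Proof.
move=> PH; have := filterI (@nbhs_right_gt _ (0 : R)) PH => /(_ _).
by move=> /filter_ex[e [/= e0 Pe]]; exists e.
Qed.

Lemma loclip_near f z : loclip f z -> exists2 K : R, 0 < K &
  \forall e \near (0 : R)^'+,
  forall x y, ball z e x -> ball z e y -> `|f x - f y| <= K * `|x - y|.
Proof.
move=> [K fK]; exists (Num.max K 1); first by rewrite lt_max ltr01 orbT.
near=> e => x y zx zy; apply: (@le_trans _ _ (K * `|x - y|)); first exact: (near fK e).
by rewrite ler_wpM2r// le_max lexx.
Unshelve. all: by end_near. Qed.

Lemma loclip_continuous f z : loclip f z -> {for z, continuous f}.
Proof.
move=> /loclip_near[K K0 fK].
apply/cvgrPdist_le => e e0.
have zz : \forall x \near z, `|f z - f x| <= K * `|z - x|.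
  have [d d0 H] := near_at_right fK.
  near=> x; apply: H; first exact: ballxx.
  by near: x; exact: nbhsx_ballx.
near=> x; apply: (@le_trans _ _ (K * `|z - x|)); first by near: x.
rewrite mulrC -ler_pdivlMr//; near: x.
have := @cvgr_dist_le _ _ _ (nbhs z) _ id z cvg_id _ (divr_gt0 e0 K0); exact.
Unshelve. all: by end_near. Qed.

Lemma loclip_eq f g z : (\forall x \near z, f x = g x) ->
  loclip f z -> loclip g z.
Proof.
move=> fg [K fK]; exists K; near=> e => x y zx zy.
have <- : f x = g x by exact: (near (near_ball fg) e).
have <- : f y = g y by exact: (near (near_ball fg) e).
exact: (near fK e).
Unshelve. all: by end_near. Qed.

Lemma loclip_ext f g z : f =1 g -> loclip f z -> loclip g z.
Proof. by move=> /funext ->. Qed.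

Lemma loclip_cst (c : R) z : loclip (fun=> c) z.
Proof. by exists 0; near=> e => x y zx zy; rewrite subrr normr0 mul0r.
Unshelve. all: by end_near. Qed.

Lemma loclip_fst z : loclip fst z.
Proof.
exists 1; near=> e => x y zx zy; rewrite mul1r.
by have [] := prod_norm_ge (x - y).
Unshelve. all: by end_near. Qed.

Lemma loclip_snd z : loclip snd z.
Proof.
exists 1; near=> e => x y zx zy; rewrite mul1r.
by have [] := prod_norm_ge (x - y).
Unshelve. all: by end_near. Qed.

Lemma loclipD f g z : loclip f z -> loclip g z -> loclip (fun x => f x + g x) z.
Proof.
move=> [K fK] [L gL]; exists (K + L); near=> e => x y zx zy.
have -> : f x + g x - (f y + g y) = (f x - f y) + (g x - g y) by ring.
rewrite (le_trans (ler_normD _ _))// mulrDl lerD//.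
  exact: (near fK e).
exact: (near gL e).
Unshelve. all: by end_near. Qed.

Lemma loclipM f g z : loclip f z -> loclip g z -> loclip (fun x => f x * g x) z.
Proof.
move=> /[dup] /loclip_continuous cf [K fK] /[dup] /loclip_continuous cg [L gL].
have bnd (h : pt R -> R) : {for z, continuous h} ->
    \forall x \near z, `|h x| <= `|h z| + 1.
  move=> /cvgrPdist_le /(_ _ ltr01); apply: filterS => x.
  rewrite distrC => hx; rewrite -lerBlDl (le_trans _ hx)//.
  exact: lerB_dist.
exists (L * (`|f z| + 1) + K * (`|g z| + 1)); near=> e => x y zx zy.
have -> : f x * g x - f y * g y = f x * (g x - g y) + g y * (f x - f y) by ring.
rewrite (le_trans (ler_normD _ _))// !normrM mulrDl.
have fx : `|f x| <= `|f z| + 1 by exact: (near (near_ball (bnd _ cf)) e).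
have gy : `|g y| <= `|g z| + 1 by exact: (near (near_ball (bnd _ cg)) e).
have fxy : `|f x - f y| <= K * `|x - y| by exact: (near fK e).
have gxy : `|g x - g y| <= L * `|x - y| by exact: (near gL e).
apply: lerD.
  rewrite (_ : _ * _ * _ = (`|f z| + 1) * (L * `|x - y|)); last by ring.
  exact: ler_pM.
rewrite (_ : K * _ * _ = (`|g z| + 1) * (K * `|x - y|)); last by ring.
exact: ler_pM.
Unshelve. all: by end_near. Qed.

Lemma loclipN f z : loclip f z -> loclip (fun x => - f x) z.
Proof.
move=> /(loclipM (loclip_cst (-1) z)); apply: loclip_ext => x.
by rewrite mulN1r.
Qed.

Lemma loclipB f g z : loclip f z -> loclip g z -> loclip (fun x => f x - g x) z.
Proof. by move=> fl /loclipN; exact: loclipD. Qed.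

Lemma loclip_sum (I : Type) (r : seq I) (P : pred I) (f : I -> pt R -> R) z :
  (forall i, P i -> loclip (f i) z) ->
  loclip (fun x => \sum_(i <- r | P i) f i x) z.
Proof.
move=> fl; elim: r => [|i r IH].
  apply: loclip_ext (loclip_cst 0 z) => x.
  by rewrite big_nil.
have [Pi|Pi] := boolP (P i); last first.
  apply: loclip_ext IH => x.
  by rewrite big_cons (negbTE Pi).
apply: loclip_ext (loclipD (fl i Pi) IH) => x.
by rewrite big_cons Pi.
Qed.

Lemma loclipV f z : f z != 0 -> loclip f z -> loclip (fun x => (f x)^-1) z.
Proof.
move=> fz0 /[dup] /loclip_continuous cf /loclip_near[K K0 fK].
have f0 : 0 < `|f z| by rewrite normr_gt0.
have bnd : \forall x \near z, `|f z| / 2 <= `|f x|.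
  have h : 0 < `|f z| / 2 by lra.
  move/cvgrPdist_le : cf => /(_ _ h); apply: filterS => x.
  have := lerB_dist (f z) (f x); lra.
exists (K / (`|f z| / 2) ^+ 2); near=> e => x y zx zy.
have fx : `|f z| / 2 <= `|f x| by exact: (near (near_ball bnd) e).
have fy : `|f z| / 2 <= `|f y| by exact: (near (near_ball bnd) e).
have fx0 : f x != 0 by rewrite -normr_gt0; lra.
have fy0 : f y != 0 by rewrite -normr_gt0; lra.
have -> : (f x)^-1 - (f y)^-1 = (f y - f x) * ((f x)^-1 * (f y)^-1).
  by field; rewrite fx0 fy0.
rewrite normrM distrC mulrAC ler_pM//; first exact: (near fK e).
rewrite normrM !normrV ?unitfE// -invfM lef_pV2 ?posrE.
- by rewrite expr2; apply: ler_pM => //; lra.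
- by rewrite mulr_gt0//; lra.
- by rewrite exprn_gt0//; lra.
Unshelve. all: by end_near. Qed.

Lemma loclip_min f g z : loclip f z -> loclip g z ->
  loclip (fun x => Num.min (f x) (g x)) z.
Proof.
move=> [K fK] [L gL]; exists (Num.max K L); near=> e => x y zx zy.
have fxy : `|f x - f y| <= Num.max K L * `|x - y|.
  apply: (@le_trans _ _ (K * `|x - y|)); first exact: (near fK e).
  by rewrite ler_wpM2r// le_max lexx.
have gxy : `|g x - g y| <= Num.max K L * `|x - y|.
  apply: (@le_trans _ _ (L * `|x - y|)); first exact: (near gL e).
  by rewrite ler_wpM2r// le_max lexx orbT.
move: fxy gxy; rewrite !ler_norml => /andP[? ?] /andP[? ?].
by rewrite /Num.min; case: ltP => ?; case: ltP => ?; apply/andP; split; lra.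
Unshelve. all: by end_near. Qed.

Lemma loclip_comp f (G : pt R -> pt R) z :
  loclip (fst \o G) z -> loclip (snd \o G) z -> loclip f (G z) ->
  loclip (f \o G) z.
Proof.
move=> G1 G2 /loclip_near[K K0 fK].
have cG : G x @[x --> z] --> G z.
  apply/cvg_ballP => e e0.
  have /cvg_ballP/(_ _ e0) := loclip_continuous G1.
  have /cvg_ballP/(_ _ e0) := loclip_continuous G2.
  by apply: filterS2 => x ? ?; split.
have [K1 K10 G1K] := loclip_near G1; have [K2 K20 G2K] := loclip_near G2.
exists (K * (K1 + K2)); near=> e => x y zx zy.
apply: (@le_trans _ _ (K * `|G x - G y|)).
  move: x y zx zy; near: e.
  have [d d0 H] := near_at_right fK.
  have := cG _ (nbhsx_ballx _ _ d0) => /near_ball; apply: filterS => e He x y zx zy.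
  by apply: H; exact: He.
rewrite -mulrA ler_wpM2l//; first exact: ltW.
have h1 : `|(G x).1 - (G y).1| <= K1 * `|x - y| by exact: (near G1K e).
have h2 : `|(G x).2 - (G y).2| <= K2 * `|x - y| by exact: (near G2K e).
have := normr_ge0 (x - y).
rewrite [`|G x - G y|]/Num.norm/= ge_max mulrDl => h.
by apply/andP; split; [apply: le_trans h1 _|apply: le_trans h2 _];
  rewrite ?lerDl ?lerDr mulr_ge0// ltW.
Unshelve. all: by end_near. Qed.

(** Compactness is used in its near-covering form, the parameter being the pair of a constant
    tending to infinity and an increment tending to 0; this majorises all the local constants at
    once. The point x + h may leave K. *)
Lemma loclip_compact f (K : set (pt R)) : compact K ->
  (forall z, K z -> loclip f z) ->
  exists2 C : R, 0 < C &
    \forall h \near (0 : pt R), forall x, K x -> `|f (x + h) - f x| <= C * `|h|.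
Proof.
move=> cK fl.
have /compact_near_coveringP cov := cK.
pose P (i : R * pt R) x := `|f (x + i.2) - f x| <= i.1 * `|i.2|.
have HP : \forall i \near filter_prod (+oo : set_system R) (nbhs (0 : pt R)), K `<=` P i.
  apply: cov => x Kx.
  have [L L0 fL] := loclip_near (fl x Kx).
  have [d d0 Hd] := near_at_right fL.
  have d20 : 0 < d / 2 by lra.
  exists (ball x (d / 2), [set i | L <= i.1 /\ `|i.2| < d / 2]) => /=.
    split; first exact: nbhsx_ballx.
    exists ([set C | L <= C], ball 0 (d / 2)) => /=.
      split; last exact: nbhsx_ballx.
      by apply: nbhs_pinfty_ge; exact: num_real.
    move=> [C h] /= [LC]; rewrite -ball_normE/= sub0r normrN => hd; split => //.
  move=> [y [C h]] /= [xy [LC hd]]; rewrite /P/=.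
  apply: le_trans (Hd _ _ _ _) _; last first.
  - by rewrite addrAC subrr add0r ler_wpM2r.
  - by apply: le_ball xy; lra.
  - rewrite (splitr d); apply: ball_triangle xy _.
    by rewrite -ball_normE/= opprD addrA subrr sub0r normrN.
case: HP => -[A B] /= [Aoo B0] AB.
have [C [C0 AC]] : exists C, 0 < C /\ A C.
  by have := filterI (@nbhs_pinfty_gt R 0 (num_real _)) Aoo => /(_ _) /filter_ex[C []]; exists C.
exists C => //; apply: filterS B0 => h Bh x Kx.
by apply: (AB (C, h)).
Qed.

(** If x is in K the bound on K applies; if only x + h is in K it applies backwards from x + h; if
    neither is, both values vanish. *)
Lemma loclip_compact_support f (K : set (pt R)) : compact K ->
  (forall x, ~ K x -> f x = 0) -> (forall z, loclip f z) ->
  exists2 C : R, 0 < C &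
    \forall h \near (0 : pt R), forall x, `|f (x + h) - f x| <= C * `|h|.
Proof.
move=> cK f0 fl.
have [C C0 HC] := loclip_compact cK (fun z _ => fl z).
exists C => //.
have HCN : \forall h \near (0 : pt R), forall x, K x ->
    `|f (x - h) - f x| <= C * `|h|.
  move: HC => /nbhs_ballP[d /= d0 Hd]; apply/nbhs_ballP; exists d => //= h hd x Kx.
  rewrite -[`|h|]normrN; apply: Hd => //; move: hd.
  by rewrite -!ball_normE/= !sub0r !normrN.
near=> h => x.
have [Kx|Kx] := pselect (K x); first by move: x Kx; near: h.
have [Kh|Kh] := pselect (K (x + h)).
  have {2}-> : x = x + h - h by rewrite addrK.
  by rewrite distrC; move: (x + h) Kh; near: h.
by rewrite !f0// subrr normr0 mulr_ge0// ltW.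
Unshelve. all: by end_near. Qed.

End LocallyLipschitz.

(** * The integral of a directional derivative vanishes *)

Section IntegralOfDerivative.
Context {R : realType}.
Implicit Types (f g : pt R -> R) (j : 'I_2).

(** The step sizes of the difference quotients; the offset N makes even the first one small. *)
Definition harm (N n : nat) : R := ((n + N).+1%:R)^-1.

Lemma harm_gt0 N n : 0 < harm N n. Proof. by rewrite invr_gt0. Qed.

Lemma harm_le N n : harm N n <= (N.+1%:R)^-1.
Proof. by rewrite lef_pV2 ?posrE// ler_nat ltnS leq_addl. Qed.

Lemma cvg_harm N : harm N @ \oo --> (0 : R).
Proof.
have /= := @cvg_harmonic R.
by rewrite -(cvg_shiftn N).
Qed.

Lemma derivable_cvg_harm f N x (v : pt R) : derivable f x v ->
  ((harm N n)^-1 * (f (harm N n *: v + x) - f x)) @[n --> \oo] --> 'D_v f x.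
Proof.
move=> df; have := df; rewrite /derivable => /cvg_ex[l fl].
have -> : 'D_v f x = l by apply: cvg_lim.
move/cvgr_dnbhsP : fl => /(_ (harm N)); apply; split; last exact: cvg_harm.
by move=> n; rewrite gt_eqF// harm_gt0.
Qed.

Lemma norm_edir j : `|edir j : pt R| = 1.
Proof.
rewrite /edir prod_normE; case: ifP => _ /=; rewrite normr0 normr1.
  by rewrite max_l.
by rewrite max_r.
Qed.

Lemma box_norm (x : pt R) r : box (0, 0) r x <-> `|x| <= r.
Proof.
rewrite prod_normE ge_max /box /= !in_itv/= !sub0r !add0r -!ler_norml.
by split => [[-> ->]|/andP[]].
Qed.

Lemma integrable_bounded_support f (C r : R) :
  measurable_fun (setT : set (mplane R)) f ->
  (forall x, `|f x| <= C) -> (forall x, r < `|x| -> f x = 0) ->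
  area.-integrable (setT : set (mplane R)) (EFin \o f).
Proof.
move=> mf fC fr.
wlog r0 : r fr / 0 < r.
  move=> /(_ (Num.max r 1)); apply; last by rewrite lt_max ltr01 orbT.
  by move=> x; rewrite gt_max => /andP[? _]; exact: fr.
have mB := measurable_box (0, 0) r.
have -> : EFin \o f = (EFin \o f) \_ (box (0, 0) r).
  apply/funext => x /=; rewrite patchE; case: ifPn => // /negP xr /=.
  by rewrite fr// ltNge; apply/negP => /box_norm; rewrite -inE.
apply/(integrable_mkcond _ mB)/measurable_bounded_integrable => //.
- by apply: (@le_lt_trans _ _ ((2 * r) ^+ 2)%:E); [rewrite -(area_box (0, 0) r0)|rewrite ltry].
- exact: measurable_funS mf.
- exists C; split; first exact: num_real.
  by move=> M CM x _; apply: le_trans (fC x) _; exact: ltW.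
Qed.

(* The difference quotients of f have integral 0 by translation invariance of
   the area, and they are dominated. *)
Lemma integral_derive0 f g (K : set (pt R)) j :
  compact K -> (forall x, ~ K x -> f x = 0) -> (forall z, loclip f z) ->
  measurable_fun (setT : set (mplane R)) g ->
  {ae area, forall x : mplane R, derivable f x (edir j) /\ 'D_(edir j) f x = g x} ->
  area.-integrable (setT : set (mplane R)) (EFin \o g) /\
  (\int[area]_x (g x)%:E = 0)%E.
Proof.
move=> cK f0 fl mg fg.
have cf : continuous f by move=> x; exact: loclip_continuous.
have mf := measurable_fun_continuous cf.
have [C C0] := loclip_compact_support cK f0 fl.
move=> /nbhs_ballP[d /= d0 Hd].
have [r [r0 Kr]] : exists r, 0 < r /\ forall x, K x -> `|x| <= r.
  have [M [_ HM]] := compact_bounded cK.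
  exists (`|M| + 1); split; first by rewrite ltr_pwDr.
  by apply: HM; rewrite (le_lt_trans (ler_norm _))// ltrDl.
have fr x : r < `|x| -> f x = 0.
  by move=> rx; apply: f0 => /Kr; rewrite leNgt rx.
have [D fD] : exists D, forall x, `|f x| <= D.
  have [] := @compact_bounded _ _ (f @` K).
    by apply: continuous_compact => //; exact: continuous_subspaceT.
  move=> M [_ HM]; exists (`|M| + 1) => x.
  have [Kx|Kx] := pselect (K x); last by rewrite f0// normr0 addr_ge0.
  by apply: HM; [rewrite (le_lt_trans (ler_norm _))// ltrDl|exists x].
have fi := integrable_bounded_support mf fD fr.
(* Steps below d obey the uniform Lipschitz bound; steps below 1 keep every shifted support within
   radius r + 1, so C times the indicator of one box dominates all the quotients. *)
have [N hN] : exists N : nat, N.+1%:R^-1 < Num.min d 1.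
  have [N] : exists N : nat, 0 + N.+1%:R^-1 < Num.min d 1.
    by apply: ltr_add_invr; rewrite lt_min d0 ltr01.
  by rewrite add0r; exists N.
have harmd n : harm N n < d /\ harm N n < 1.
  by have := le_lt_trans (harm_le N n) hN; rewrite lt_min => /andP[].
pose e := edir j : pt R.
pose q n (x : mplane R) : R := (harm N n)^-1 * (f (harm N n *: e + x) - f x).
have fsE n : (fun x => f (harm N n *: e + x)) = f \o translate (harm N n *: e).
  apply/funext => x /=; congr f; rewrite /translate.
  by case: x => a b; rewrite /= [in LHS]addrC.
have mfs n : measurable_fun (setT : set (mplane R)) (fun x => f (harm N n *: e + x)).
  by rewrite fsE; exact: measurableT_comp mf (measurable_translate _).
have mq n : measurable_fun setT (q n).
  by apply: measurable_funM => //; apply: measurable_funB.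
have normh n : `|harm N n *: e| = harm N n.
  by rewrite normrZ norm_edir mulr1 ger0_norm// ltW// harm_gt0.
have qC n x : `|q n x| <= C.
  rewrite normrM gtr0_norm ?invr_gt0 ?harm_gt0//.
  rewrite mulrC ler_pdivrMr ?harm_gt0//.
  have := Hd (harm N n *: e) _ x; rewrite normh (addrC x); apply.
  by rewrite -ball_normE/= sub0r normrN normh; have [] := harmd n.
have q0 n x : r + 1 < `|x| -> q n x = 0.
  move=> rx; have [_ h1] := harmd n.
  rewrite /q [f x]fr ?fr ?subrr ?mulr0//; last by lra.
  have := ler_normB (harm N n *: e + x) (harm N n *: e).
  by rewrite normh addrAC subrr add0r; lra.
have qi n : area.-integrable setT (EFin \o q n).
  exact: integrable_bounded_support (mq n) (qC n) (q0 n).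
have fsi n : area.-integrable (setT : set (mplane R))
    (EFin \o (fun x => f (harm N n *: e + x))).
  apply: (integrable_bounded_support (C := D) (r := r + 1)) => // x rx.
  apply: fr; have [_ h1] := harmd n.
  have := ler_normB (harm N n *: e + x) (harm N n *: e).
  by rewrite normh addrAC subrr add0r; lra.
have Iq n : (\int[area]_x (q n x)%:E = 0)%E.
  rewrite /q; under eq_integral do rewrite EFinM.
  rewrite integralZl//; last first.
    by apply: (integrableB measurableT (fsi n) fi).
  under eq_integral do rewrite EFinB.
  rewrite (integralB_EFin measurableT (fsi n) fi).
  have -> : (\int[area]_x (f (harm N n *: e + x)%R)%:E = \int[area]_x (f x)%:E)%E.
    rewrite -[RHS](integral_translate (harm N n *: e))//.
    apply: eq_integral => x _; congr EFin.
    by have /(congr1 (fun h => h x)) := fsE n.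
  by rewrite subee ?mule0//; exact: integrable_fin_num fi.
have gC : area.-integrable (setT : set (mplane R)) (EFin \o (C \o* \1_(box (0,0) (r + 1)))).
  apply: (integrable_bounded_support (C := C) (r := r + 1)).
  - by apply: measurable_funM => //; apply: measurable_indic; exact: measurable_box.
  - move=> x; rewrite /= indicE; case: (x \in _).
      by rewrite mul1r gtr0_norm.
    by rewrite mul0r normr0 ltW.
  - move=> x rx; rewrite /= indicE memNset ?mul0r// => /box_norm.
    by rewrite leNgt rx.
have mqE n : measurable_fun setT (EFin \o q n) by apply/measurable_EFinP; exact: mq.
have mgE : measurable_fun (setT : set (mplane R)) (EFin \o g) by exact/measurable_EFinP.
have qg : {ae area, forall x : mplane R, setT x -> (EFin \o q n) x @[n --> \oo] --> (EFin \o g) x}.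
  apply: filterS fg => x [dx gx] _ /=; rewrite -gx.
  apply: cvg_EFin; first exact: nearW.
  exact: derivable_cvg_harm.
have qd : {ae area, forall (x : mplane R) n, setT x ->
    (`|(EFin \o q n) x| <= (EFin \o (C \o* \1_(box (0%R, 0%R) (r + 1)%R))%R) x)%E}.
  apply: aeW => x n _; rewrite /= lee_fin indicE.
  have [_|] := boolP (x \in _); first by rewrite mul1r.
  move=> /negP xr; rewrite mul0r q0 ?normr0// ltNge; apply/negP => /box_norm.
  by rewrite -inE.
have [gi _ cI] := dominated_convergence measurableT mqE mgE qg gC qd.
split => //.
rewrite -(cvg_lim _ cI)//; apply: (@cvg_lim _ _ _ \oo) => //.
by under eq_fun do rewrite Iq; exact: cvg_cst.
Qed.

End IntegralOfDerivative.

(** * Lipschitz functions belong to H^1 *)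

Section LipschitzSobolev.
Context {R : realType}.
Implicit Types (f g u : pt R -> R) (U D : set (pt R)) (j : 'I_2).

Lemma is_derive_line f (a v : pt R) (t : R) : derivable f (a + t *: v) v ->
  is_derive t 1 (fun s : R => f (a + s *: v)) ('D_v f (a + t *: v)).
Proof.
move=> df; have E : (fun h : R => h^-1 *: (((fun s => f (a + s *: v)) \o shift t) (h *: (1 : R)) - f (a + t *: v)))
   = (fun h => h^-1 *: ((f \o shift (a + t *: v)) (h *: v) - f (a + t *: v))).
  apply/funext => h /=; congr (_ *: (f _ - _)).
  by rewrite /shift/= [h *: 1]mulr1 scalerDl addrCA addrA.
apply: DeriveDef; first by rewrite /derivable E.
by rewrite /derive E.
Qed.

(** The mean value theorem along a line. The two conditions on t say that t lies between 0 and s,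
    whatever the sign of s; a negative s is handled by starting from the other end of the
    segment. *)
Lemma line_increment f (a v : pt R) (s K : R) :
  (forall t, `|t| <= `|s| -> 0 <= t * s ->
     derivable f (a + t *: v) v /\ `|'D_v f (a + t *: v)| <= K) ->
  `|f (a + s *: v) - f a| <= K * `|s|.
Proof.
suff pos (b w : pt R) (r : R) : 0 <= r ->
    (forall t, 0 <= t <= r -> derivable f (b + t *: w) w /\
       `|'D_w f (b + t *: w)| <= K) ->
    `|f (b + r *: w) - f b| <= K * r.
  move=> H; have [s0|s0] := leP 0 s.
    rewrite [`|s|]ger0_norm//; apply: pos => // t /andP[t0 ts]; apply: H.
      by rewrite !ger0_norm.
    exact: mulr_ge0.
  have := pos (a + s *: v) v (- s); rewrite scaleNr addrK => P.
  rewrite distrC [`|s|]ltr0_norm//; apply: P; first by lra.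
  move=> t /andP[t0 ts]; rewrite -addrA -scalerDl; apply: H.
    by rewrite [leRHS]ltr0_norm// ler_norml; apply/andP; split; lra.
  by apply: mulr_le0; lra.
move=> r0 H.
pose F (s : R) := f (b + s *: w); pose dF (s : R) := 'D_w f (b + s *: w).
have h (t : R) : t \in `[0, r] -> is_derive t 1 F (dF t).
  by rewrite in_itv/= => /H[+ _]; exact: is_derive_line.
have cF : {within `[0, r], continuous F}.
  by apply: derivable_within_continuous => t /h dt; exact: ex_derive.
have h' (t : R) : t \in `]0, r[ -> is_derive t 1 F (dF t).
  by move=> tr; apply: h; apply: subset_itv_oo_cc.
have [c] := MVT_segment r0 h' cF.
rewrite /F /dF in_itv/= => c0r; rewrite scale0r addr0 subr0 => ->.
by rewrite normrM [`|r|]ger0_norm// ler_wpM2r//; have [] := H c c0r.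
Qed.

Lemma ball_between (c a b t e : R) : ball c e a -> ball c e b ->
  `|t| <= `|b - a| -> 0 <= t * (b - a) -> ball c e (a + t).
Proof.
rewrite /ball/= !ltr_distlC => /andP[? ?] /andP[? ?].
have [ab|ab] := leP 0 (b - a).
  rewrite (ger0_norm ab) ler_norml => /andP[? ?].
  have [t0|t0] := leP 0 t; first by move=> _; apply/andP; split; lra.
  have [E|ab0] := eqVneq (b - a) 0; first by move=> _; apply/andP; split; lra.
  by rewrite pmulr_lge0 ?lt_neqAle 1?eq_sym ?ab0//; lra.
rewrite (ltr0_norm ab) ler_norml nmulr_lge0// => /andP[? ?] ?.
by apply/andP; split; lra.
Qed.

(** Two points are joined by two axis-parallel segments through the corner (y.1, x.2). Balls of the
    product norm are squares, so this path stays in the ball, where continuity bounds the partial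
    derivatives. *)
Lemma Ck1_loclip U f z : open U -> Ck 1 U f -> U z -> loclip f z.
Proof.
move=> oU C1 Uz.
have bnd j : \forall x \near z, derivable f x (edir j) /\
    `|'D_(edir j) f x| <= `|'D_(edir j) f z| + 1.
  have [df cdf] := C1 j.
  have /cvgrPdist_le/(_ _ ltr01) h := cdf z Uz.
  have oUz : \forall x \near z, U x by apply: open_nbhs_nbhs.
  near=> x; split; first by apply: df; near: x.
  have hx : `|'D_(edir j) f z - 'D_(edir j) f x| <= 1 by near: x.
  rewrite -lerBlDl (le_trans _ hx)// distrC; exact: lerB_dist.
exists ((`|'D_(edir 0) f z| + 1) + (`|'D_(edir 1) f z| + 1)).
near=> e => x y zx zy.
have B j := near (near_ball (bnd j)) e.
have b0 : forall x, ball z e x -> derivable f x (edir 0) /\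
    `|'D_(edir 0) f x| <= `|'D_(edir 0) f z| + 1 by apply: B.
have b1 : forall x, ball z e x -> derivable f x (edir 1) /\
    `|'D_(edir 1) f x| <= `|'D_(edir 1) f z| + 1 by apply: B.
have E0 : (y.1, x.2) + (x.1 - y.1) *: edir 0 = x.
  rewrite /edir/= [RHS]surjective_pairing; congr (_, _) => /=.
    by rewrite [_ *: 1]mulr1 addrC subrK.
  by rewrite scaler0 addr0.
have E1 : y + (x.2 - y.2) *: edir 1 = (y.1, x.2).
  rewrite /edir/= [X in X + _]surjective_pairing; congr (_, _) => /=.
    by rewrite scaler0 addr0.
  by rewrite [_ *: 1]mulr1 addrC subrK.
have x1 : `|f x - f (y.1, x.2)| <= (`|'D_(edir 0) f z| + 1) * `|x.1 - y.1|.
  have L : forall t, `|t| <= `|x.1 - y.1| -> 0 <= t * (x.1 - y.1) ->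
      ball z e ((y.1, x.2) + t *: edir 0).
    move=> t tl t0; rewrite /edir/=; split => /=; last by rewrite scaler0 addr0; exact: zx.2.
    rewrite [_ *: 1]mulr1; apply: (ball_between (b := x.1)) => //.
      exact: zy.1.
    exact: zx.1.
  by rewrite -{1}E0; apply: line_increment => t tl t0; apply: b0; apply: L.
have y1 : `|f (y.1, x.2) - f y| <= (`|'D_(edir 1) f z| + 1) * `|x.2 - y.2|.
  have L : forall t, `|t| <= `|x.2 - y.2| -> 0 <= t * (x.2 - y.2) ->
      ball z e (y + t *: edir 1).
    move=> t tl t0; rewrite /edir/=; split => /=; first by rewrite scaler0 addr0; exact: zy.1.
    rewrite [_ *: 1]mulr1; apply: (ball_between (b := x.2)) => //.
      exact: zy.2.
    exact: zx.2.
  by rewrite -E1; apply: line_increment => t tl t0; apply: b1; apply: L.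
have [n1 n2] := prod_norm_ge (x - y).
rewrite -(subrKA (f (y.1, x.2))) (le_trans (ler_normD _ _))// mulrDl lerD//.
  by rewrite (le_trans x1)// ler_wpM2l// addr_ge0.
by rewrite (le_trans y1)// ler_wpM2l// addr_ge0.
Unshelve. all: by end_near. Qed.

Lemma area_compact_interior D : compact D -> (area D° < +oo)%E.
Proof.
move=> cD; have [M [_ HM]] := compact_bounded cD.
pose r := `|M| + 1.
have r0 : 0 < r by rewrite ltr_pwDr.
apply: (@le_lt_trans _ _ (area (box (0, 0) r))).
  apply: le_measure; rewrite ?inE.
  - by apply: measurable_open; exact: open_interior.
  - exact: measurable_box.
  - move=> x /interior_subset Dx; apply/box_norm.
    by apply: HM => //; rewrite (le_lt_trans (ler_norm _))// ltrDl.
by rewrite area_box// ltry.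
Qed.

Lemma integrable_bounded U f (C : R) : measurable (U : set (mplane R)) ->
  (area U < +oo)%E -> measurable_fun (U : set (mplane R)) f ->
  (forall x, U x -> `|f x| <= C) ->
  area.-integrable (U : set (mplane R)) (EFin \o f).
Proof.
move=> mU aU mf fC; apply: measurable_bounded_integrable => //.
exists C; split; first exact: num_real.
by move=> M CM x Ux; apply: le_trans (fC x Ux) _; exact: ltW.
Qed.

Lemma L2_bounded U f (C : R) : measurable (U : set (mplane R)) ->
  (area U < +oo)%E -> measurable_fun (U : set (mplane R)) f ->
  (forall x, U x -> `|f x| <= C) -> L2 U f.
Proof.
move=> mU aU mf fC; split => //.
have mf2 : measurable_fun (U : set (mplane R)) (fun x => `|f x| ^+ 2).
  by apply: measurable_funX; exact: measurableT_comp.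
have bnd x : U x -> `| `|f x| ^+ 2 | <= C ^+ 2.
  move=> Ux; rewrite normrX normr_id lerXn2r ?nnegrE ?fC//.
  by apply: le_trans (fC x Ux).
have /integrableP[_] := integrable_bounded mU aU mf2 bnd.
apply: le_lt_trans; apply: ge0_le_integral => //.
- exact/measurable_EFinP.
- by apply/measurableT_comp => //; exact/measurable_EFinP.
- by move=> x _; rewrite /= lee_fin ler_norm.
Qed.

Lemma continuous_compact_bounded D f : compact D ->
  (forall x, D x -> {for x, continuous f}) ->
  exists2 C : R, 0 < C & forall x, D x -> `|f x| <= C.
Proof.
move=> cD cf; have [] := @compact_bounded _ _ (f @` D).
  apply: continuous_compact => //.
  by apply: continuous_in_subspaceT => x /set_mem; exact: cf.
move=> M [_ HM]; exists (`|M| + 1) => [|x Dx]; first by rewrite ltr_pwDr.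
by apply: HM; [rewrite (le_lt_trans (ler_norm _))// ltrDl|exists x].
Qed.

Lemma derivable_eq0_near f (x v : pt R) : (\forall y \near x, f y = 0) ->
  derivable f x v /\ 'D_v f x = 0.
Proof.
move=> f0; have e0 : \forall y \near x, cst 0 y = f y.
  by apply: filterS f0 => y ->.
split; first by apply: near_eq_derivable e0 (derivable_cst _ _ _).
by rewrite -(near_eq_derive _ e0) derive_cst.
Qed.

(** The weak derivative is built as an upper limit of difference quotients, which is measurable by
    construction, and it equals the classical derivative at almost every interior point. *)
Lemma loclip_H1 D u : compact D -> (forall z, D z -> loclip u z) ->
  {ae area, forall x : mplane R, D° x -> forall j, derivable u x (edir j)} ->
  H1 D u.
Proof.
move=> cD ul ud.
have oD : open D° := open_interior D.
have mD : measurable (D° : set (mplane R)) by exact: measurable_open.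
have aD := area_compact_interior cD.
have cu x : D x -> {for x, continuous u} by move=> Dx; exact/loclip_continuous/ul.
have mu : measurable_fun (D° : set (mplane R)) u.
  by apply: measurable_fun_open => // x /set_mem /interior_subset; exact: cu.
have [B B0 uB] := continuous_compact_bounded cD cu.
have [C C0 uC] := loclip_compact cD ul.
have {}uB x : D° x -> `|u x| <= B by move=> /interior_subset; exact: uB.
split; first exact: L2_bounded uB.
move=> j; pose e := edir j : pt R.
(* Extension by zero makes the quotients measurable on the whole plane; at an interior point they
   are eventually those of u. *)
pose u0 := u \_ D°.
have mu0 : measurable_fun (setT : set (mplane R)) u0 by exact/(measurable_restrictT _ mD).
pose q n (x : mplane R) : R := (harm 0 n)^-1 * (u0 (harm 0 n *: e + x) - u0 x).
have mq n : measurable_fun setT (q n).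
  apply: measurable_funM => //; apply: measurable_funB => //.
  have -> : (fun x : mplane R => u0 (harm 0 n *: e + x)) = u0 \o translate (harm 0 n *: e).
    by apply/funext => -[a b] /=; congr u0; rewrite /translate /= [in LHS]addrC.
  exact: measurableT_comp mu0 (measurable_translate _).
(* Truncation at -C and C, where C is the Lipschitz constant, does not alter an existing derivative
   at an interior point, and makes the argument of [fine] finite everywhere. *)
pose g (x : mplane R) : R := fine (maxe (- C)%:E (mine C%:E (limn_esup (fun n => (q n x)%:E)))).
have mg : measurable_fun setT g.
  apply: measurableT_comp; first exact: fine_measurable.
  apply: measurable_maxe => //; apply: measurable_mine => //.
  by apply: measurable_fun_limn_esup => n; exact/measurable_EFinP.
have gC x : `|g x| <= C.
  rewrite /g; set w := mine _ _.
  have w1 : (w <= C%:E)%E by rewrite /w ge_min lexx.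
  have : ((- C)%:E <= maxe (- C)%:E w)%E by rewrite le_max lexx.
  have : (maxe (- C)%:E w <= C%:E)%E.
    by rewrite ge_max w1 andbT lee_fin; lra.
  by case: (maxe _ _) => //= r; rewrite !lee_fin ler_norml => -> ->.
have near_harm x (P : pt R -> Prop) : (\forall y \near x, P y) ->
    \forall n \near \oo, P (harm 0 n *: e + x).
  move=> /nbhs_ballP[d /= d0 dP].
  have := @cvg_harm R 0 => /cvgrPdist_lt/(_ _ d0); apply: filterS => n.
  rewrite sub0r normrN => hd; apply: dP.
  by rewrite -ball_normE/= opprD addrCA subrr addr0 normrN normrZ norm_edir mulr1.
have gE x : D° x -> derivable u x e -> g x = 'D_e u x.
  move=> Dx du; have cq := derivable_cvg_harm 0 du.
  have uE : \forall n \near \oo, (harm 0 n)^-1 * (u (harm 0 n *: e + x) - u x) = q n x.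
    have : \forall y \near x, D° y by apply: open_nbhs_nbhs.
    move=> /near_harm; apply: filterS => n Dn.
    by rewrite /q /u0 !patchE !mem_set.
  have qD : (q n x)%:E @[n --> \oo] --> ('D_e u x)%:E.
    apply: cvg_EFin; first exact: nearW.
    by apply: cvg_trans cq; exact: near_eq_cvg.
  have DC : `|'D_e u x| <= C.
    apply: (ler_cvg_to (cvg_norm cq) (cvg_cst C)).
    have : \forall y \near x, `|u y - u x| <= C * `|y - x|.
      move/nbhs_ballP : uC => [d /= d0 dC]; apply/nbhs_ballP; exists d => //= y.
      rewrite -ball_normE/= distrC => xy.
      have := dC (y - x) _ x (interior_subset Dx); rewrite subrKC; apply.
      by rewrite -ball_normE/= sub0r normrN.
    move=> /near_harm; apply: filterS => n.
    rewrite addrK normrZ norm_edir mulr1 normrM (gtr0_norm (harm_gt0 _ _)) => H.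
    by rewrite gtr0_norm ?invr_gt0 ?harm_gt0// mulrC ler_pdivrMr ?harm_gt0.
  rewrite /g (cvg_limn_einf_sup qD).2.
  move: DC; rewrite ler_norml => /andP[D1 D2].
  by rewrite min_r ?lee_fin// max_r// lee_fin.
exists g.
  have mgD : measurable_fun (D° : set (mplane R)) g by exact: measurable_funS mg.
  exact: (L2_bounded mD aD mgD (fun x _ => gC x)).
move=> phi [sphi [K [cK KD phi0]]].
have cphi : continuous phi by move=> x; exact: (sphi 0%N).
have dphi x : derivable phi x e by have [h _] := sphi 1%N j; exact: h.
have cdphi : continuous ('D_e phi) by move=> x; have [_] := sphi 1%N j; exact.
have phil z : loclip phi z by exact: (Ck1_loclip openT (sphi 1%N)).
have phiK x : ~ K x -> \forall y \near x, phi y = 0.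
  move=> Kx; have : open (~` K).
    by apply: closed_openC; apply: compact_closed => //; exact: norm_hausdorff.
  by rewrite openE => /(_ x Kx); apply: filterS => y; exact: phi0.
(* This product is Lipschitz on the plane although u is so only on D, as phi vanishes near every
   point outside K. Its derivative is almost everywhere the sum of the two integrands of the weak
   formula. *)
pose psi x := u x * phi x.
have psi0 x : ~ K x -> psi x = 0 by move=> /phi0; rewrite /psi => ->; rewrite mulr0.
have psil z : loclip psi z.
  have [Kz|Kz] := pselect (K z).
    by apply: loclipM => //; apply: ul; exact: interior_subset (KD _ Kz).
  apply: loclip_eq (loclip_cst 0 z); apply: filterS (phiK z Kz) => y.
  by rewrite /psi => ->; rewrite mulr0.
pose G : mplane R -> R := (fun x => g x * phi x + u x * 'D_e phi x) \_ D°.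
have mphi := measurable_fun_continuous cphi.
have mdphi := measurable_fun_continuous cdphi.
have mg1 : measurable_fun (D° : set (mplane R)) (fun x => g x * phi x).
  by apply: measurable_funM; [exact: measurable_funS mg|exact: measurable_funS mphi].
have mg2 : measurable_fun (D° : set (mplane R)) (fun x => u x * 'D_e phi x).
  by apply: measurable_funM => //; exact: measurable_funS mdphi.
have mG : measurable_fun (setT : set (mplane R)) G.
  by apply/(measurable_restrictT _ mD); exact: measurable_funD.
have psiG : {ae area, forall x : mplane R,
    derivable psi x e /\ 'D_e psi x = G x}.
  apply: filterS ud => x dx; rewrite /G patchE.
  case: ifPn => [/set_mem Dx|/negP nDx].
    have du := dx Dx j; split; first exact: derivableM.
    by rewrite deriveM// gE// addrC /GRing.scale/= [X in X + _]mulrC.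
  apply: derivable_eq0_near; have /phiK : ~ K x by move=> /KD; rewrite -inE.
  by apply: filterS => y; rewrite /psi => ->; rewrite mulr0.
have [_ IG] := integral_derive0 cK psi0 psil mG psiG.
have [P P0 phiP] := continuous_compact_bounded cD (fun x _ => cphi x).
have [Q Q0 phiQ] := continuous_compact_bounded cD (fun x _ => cdphi x).
have i1 : area.-integrable (D° : set (mplane R)) (EFin \o (fun x => g x * phi x)).
  apply: (integrable_bounded (C := C * P)) => // x /interior_subset Dx.
  by rewrite normrM ler_pM//; exact: phiP.
have i2 : area.-integrable (D° : set (mplane R)) (EFin \o (fun x => u x * 'D_e phi x)).
  apply: (integrable_bounded (C := B * Q)) => // x Dx.
  by rewrite normrM ler_pM//; [exact: uB|exact: phiQ (interior_subset Dx)].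
apply/eqP; rewrite -addr_eq0 -RintegralD//; apply/eqP.
rewrite Rintegral_mkcond /Rintegral.
rewrite [X in fine X](_ : _ = 0%E)// -[RHS]IG; apply: eq_integral => x _.
by congr EFin; rewrite /G !patchE; case: ifP => // _; rewrite addrC.
Qed.

End LipschitzSobolev.

(** * Flat functions at the origin *)

Section FlatFunction.
Context {R : realType}.

(** The case n = 0 is the usual e^(-1/s) cutoff. The powers s^(-n) are included because they appear
    on differentiation: the family spans a space stable under derivatives. *)
Definition flat (n : nat) (s : R) : R :=
  if 0 < s then s^-1 ^+ n * expR (- s^-1) else 0.

Lemma flat_ge0 n s : 0 <= flat n s.
Proof.
rewrite /flat; case: ifP => // s0.
by rewrite mulr_ge0 ?expR_ge0// exprn_ge0// invr_ge0 ltW.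
Qed.

Lemma flat_gt0 n s : 0 < s -> 0 < flat n s.
Proof. by move=> s0; rewrite /flat s0 mulr_gt0 ?expR_gt0// exprn_gt0// invr_gt0. Qed.

Lemma flat_eq0 n s : s <= 0 -> flat n s = 0.
Proof. by move=> s0; rewrite /flat ltNge s0. Qed.

Lemma flat0_le1 s : flat 0 s <= 1.
Proof.
rewrite /flat; case: ifP => // s0; rewrite mul1r -expR0 ler_expR.
by rewrite lerNl oppr0 invr_ge0 ltW.
Qed.

(* e^{-1/s} = (e^{-1/(ks)})^k <= (k s)^k, with k = n + 1 *)
Lemma flat_le n s : 0 < s -> flat n s <= n.+1%:R ^+ n.+1 * s.
Proof.
move=> s0; rewrite /flat s0.
have k0 : 0 < n.+1%:R :> R by rewrite ltr0n.
have ks0 : 0 < n.+1%:R * s by rewrite mulr_gt0.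
have h : expR (- s^-1) <= (n.+1%:R * s) ^+ n.+1.
  have -> : - s^-1 = - (n.+1%:R * s)^-1 * n.+1%:R.
    by field; rewrite !gt_eqF.
  rewrite expRM_natr lerXn2r ?nnegrE ?expR_ge0 ?(ltW ks0)//.
  rewrite expRN -[leRHS]invrK lef_pV2 ?posrE ?expR_gt0 ?invr_gt0//.
  by apply: le_trans (expR_ge1Dx _); rewrite lerDr.
apply: (@le_trans _ _ (s^-1 ^+ n * (n.+1%:R * s) ^+ n.+1)).
  by rewrite ler_wpM2l// exprn_ge0// invr_ge0 ltW.
rewrite exprMn mulrCA ler_wpM2l ?exprn_ge0 ?(ltW k0)//.
by rewrite exprSr mulrA -exprMn mulVf ?gt_eqF// expr1n mul1r.
Qed.

(** At s = 0 the difference quotient of [flat n] is [flat n.+1] on the right, which [flat_le] bounds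
    by a multiple of the step, and 0 on the left. *)
Lemma is_derive_flat n (s : R) :
  is_derive s 1 (flat n) (flat n.+2 s - n%:R * flat n.+1 s).
Proof.
have [s0|s0|->] := ltgtP s 0.
- rewrite !flat_eq0 ?ltW// mulr0 subr0.
  have dc : is_derive s 1 (cst (0 : R)) (0 : R) by exact: is_derive_cst.
  apply: near_eq_is_derive dc.
  near=> t; rewrite flat_eq0//; near: t.
  by apply: filterS (lt_nbhsl s0) => t /ltW.
- have sN0 : s != 0 by rewrite gt_eqF.
  have dV : is_derive s 1 (fun t : R => t^-1) (- s^-1 ^+ 2).
    by apply: is_derive_eq (is_deriveV _ _) _; rewrite // exprVn [LHS]mulr1.
  have dX : is_derive s 1 (fun t : R => t^-1 ^+ n) (- (n%:R * s^-1 ^+ n.+1)).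
    elim: n => [|n IH]; first by rewrite mul0r oppr0; exact: is_derive_cst.
    have -> : (fun t : R => t^-1 ^+ n.+1) = (fun t => t^-1) * (fun t => t^-1 ^+ n).
      by apply/funext => t; rewrite exprS.
    apply: is_derive_eq (is_deriveM dV IH) _.
    by rewrite /GRing.scale/= -[n.+1%:R]natr1 !exprS; ring.
  have dE : is_derive s 1 (fun t : R => expR (- t^-1)) (expR (- s^-1) * s^-1 ^+ 2).
    have := @is_derive1_comp R expR (fun t => - t^-1) s _ _
      (is_derive_expR (- s^-1)) (is_deriveN dV).
    by rewrite opprK.
  have dD : is_derive s 1 (fun t : R => t^-1 ^+ n * expR (- t^-1))
      (flat n.+2 s - n%:R * flat n.+1 s).
    apply: is_derive_eq (is_deriveM dX dE) _.
    by rewrite /flat s0 /GRing.scale/= !exprS; ring.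
  apply: near_eq_is_derive dD.
  near=> t; rewrite /flat ifT//; near: t.
  have sN : - s < 0 by rewrite oppr_lt0.
  by apply: filterS (Nlt_nbhsl sN) => t; rewrite oppr_lt0.
- rewrite !flat_eq0// mulr0 subr0.
  have q0 : (fun h : R => h^-1 *: ((flat n \o shift 0) (h *: (1 : R)) - flat n 0)) @ 0^' --> (0 : R).
    apply/cvgrPdist_le => e e0.
    pose K : R := n.+2%:R ^+ n.+2.
    have K0 : 0 < K by rewrite exprn_gt0// ltr0n.
    near=> h; rewrite sub0r normrN /= addr0 [h *: 1]mulr1 (@flat_eq0 n 0)// subr0.
    have [h0|h0] := leP h 0; first by rewrite flat_eq0// scaler0 normr0 ltW.
    have -> : h^-1 *: flat n h = flat n.+1 h.
      by rewrite /flat h0 exprS -mulrA.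
    rewrite ger0_norm ?flat_ge0//; apply: le_trans (flat_le _ h0) _.
    rewrite mulrC -ler_pdivlMr// ltW//.
    apply: le_lt_trans (ler_norm h) _; near: h.
    by apply: dnbhs0_lt; rewrite divr_gt0.
  apply: DeriveDef; first by apply/cvg_ex; exists 0.
  exact: cvg_lim.
Unshelve. all: by end_near. Qed.

End FlatFunction.

(** * An inductive class of smooth functions *)

Section Smooth.
Context {R : realType}.

(** Every partial derivative of a member is again a member, so [Ck k] for all k follows by induction
    with no derivative computed. The class contains the polynomials and the cutoffs used as test
    functions. *)
Inductive smooth : (pt R -> R) -> Prop :=
| smooth_cst c : smooth (fun=> c)
| smooth_fst : smooth fst
| smooth_snd : smooth snd
| smoothD f g : smooth f -> smooth g -> smooth (fun x => f x + g x)
| smoothM f g : smooth f -> smooth g -> smooth (fun x => f x * g x)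
| smooth_flat n f : smooth f -> smooth (fun x => flat n (f x)).

(** Reduces directional derivatives to derivatives in one real variable, where the chain rule and
    the automatic derivation rules apply. *)
Lemma is_derive_line0 (f : pt R -> R) (x v : pt R) (d : R) :
  is_derive x v f d <-> is_derive (0 : R) 1 (fun t : R => f (x + t *: v)) d.
Proof.
have E : (fun h : R => h^-1 *: (((fun s : R => f (x + s *: v)) \o shift 0) (h *: (1 : R)) - f (x + (0 : R) *: v)))
   = (fun h => h^-1 *: ((f \o shift x) (h *: v) - f x)).
  apply/funext => h /=; congr (_ *: (f _ - f _)).
    by rewrite /shift/= [h *: 1]mulr1 addr0 addrC.
  by rewrite scale0r addr0.
split => -[df fd]; apply: DeriveDef.
- by rewrite /derivable E.
- by rewrite /derive E.
- by rewrite /derivable -E.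
- by rewrite /derive -E.
Qed.

Lemma is_derive_comp_line (h : R -> R) (f : pt R -> R) (x v : pt R) (d e : R) :
  is_derive x v f d -> is_derive (f x) 1 h e ->
  is_derive x v (fun y => h (f y)) (e * d).
Proof.
move=> /is_derive_line0 fd hd; apply/is_derive_line0.
have hd' : is_derive (f (x + (0 : R) *: v)) 1 h e by rewrite scale0r addr0.
exact: (@is_derive1_comp R h (fun t : R => f (x + t *: v)) 0 e d hd' fd).
Qed.

Lemma smooth_derive f (v : pt R) : smooth f ->
  exists2 f', smooth f' & forall x, is_derive x v f (f' x).
Proof.
elim=> [c||
  |{}f g sf [f' sf' df] sg [g' sg' dg]|{}f g sf [f' sf' df] sg [g' sg' dg]
  |n {}f sf [f' sf' df]].
- by exists (fun=> 0) => [|x]; [exact: smooth_cst|exact: is_derive_cst].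
- exists (fun=> v.1) => [|x]; first exact: smooth_cst.
  apply/is_derive_line0.
  have -> : (fun t : R => (x + t *: v).1) = (fun t => x.1 + t * v.1) by [].
  by apply: is_derive_eq; rewrite /GRing.scale/=; ring.
- exists (fun=> v.2) => [|x]; first exact: smooth_cst.
  apply/is_derive_line0.
  have -> : (fun t : R => (x + t *: v).2) = (fun t => x.2 + t * v.2) by [].
  by apply: is_derive_eq; rewrite /GRing.scale/=; ring.
- by exists (fun x => f' x + g' x) => [|x]; [exact: smoothD|exact: is_deriveD].
- exists (fun x => f x * g' x + g x * f' x) => [|x].
    by apply: smoothD; exact: smoothM.
  exact: is_deriveM.
- exists (fun x => (flat n.+2 (f x) + (- n%:R) * flat n.+1 (f x)) * f' x) => [|x].
    apply: smoothM => //; apply: smoothD; first exact: smooth_flat.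
    by apply: smoothM; [exact: smooth_cst|exact: smooth_flat].
  rewrite mulNr; apply: is_derive_comp_line => //.
  exact: is_derive_flat.
Qed.

Lemma smooth_continuous f : smooth f -> continuous f.
Proof.
elim=> [c||
  |{}f g sf cf sg cg|{}f g sf cf sg cg
  |n {}f sf cf] x.
- exact: cvg_cst.
- exact: cvg_fst.
- exact: cvg_snd.
- by apply: cvgD; [exact: cf|exact: cg].
- by apply: cvgM; [exact: cf|exact: cg].
- apply: continuous_comp; first exact: cf.
  apply: differentiable_continuous; apply/derivable1_diffP.
  by have [] := is_derive_flat n (f x).
Qed.

Lemma smooth_Ck f k : smooth f -> Ck k setT f.
Proof.
elim: k f => [|k IH] f sf /=; first by move=> x _; exact: smooth_continuous.
move=> j; have [f' sf' df] := smooth_derive (edir j) sf.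
split; first by move=> x _; have [] := df x.
by rewrite (_ : 'D_(edir j) f = f'); [exact: IH|apply/funext => x; have [] := df x].
Qed.

Lemma smooth_loclip f z : smooth f -> loclip f z.
Proof. by move=> sf; apply: (Ck1_loclip openT) => //; exact: smooth_Ck. Qed.

End Smooth.

(** * Null sets, lines and integrability *)

Section AlmostEverywhere.
Context {R : realType}.
Implicit Types (z : pt R).

(** The square of half-side e/2 has positive area, so it is not contained in a null set. *)
Lemma ae_ball (P : pt R -> Prop) z (e : R) : 0 < e ->
  {ae area, forall x : mplane R, P x} -> exists2 x, ball z e x & P x.
Proof.
move=> e0 aeP; apply: contrapT => nP.
have sub : box z (e / 2) `<=` ~` [set x | P x].
  move=> x [/= x1 x2] Px; apply: nP; exists x => //.
  move: x1 x2; rewrite !in_itv/= => /andP[? ?] /andP[? ?].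
  by split; rewrite /ball/= ltr_distl; apply/andP; split; lra.
have [N [mN N0 PN]] := aeP.
have /eqP : area (box z (e / 2)) = 0.
  apply/eqP; rewrite eq_le measure_ge0 andbT -N0.
  apply: le_measure; rewrite ?inE//; first exact: measurable_box.
  by move=> x /sub Px; exact: PN.
rewrite area_box ?divr_gt0// eqe expf_eq0/= mulf_eq0 => /orP[|].
  by rewrite pnatr_eq0.
by rewrite mulf_eq0 invr_eq0 pnatr_eq0 orbF gt_eqF.
Qed.

(** The line is the countable union of its pieces over -n <= x.2 <= n, each a Lipschitz image of
    [0, 1]. *)
Lemma negligible_line (s k : R) :
  area.-negligible ([set x | x.1 = s + k * x.2] : set (mplane R)).
Proof.
pose g (n : nat) (t : R) : pt R :=
  (s + k * ((2 * t - 1) * n%:R), (2 * t - 1) * n%:R).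
have gn n : area.-negligible (g n @` `[0, 1]).
  pose L : R := 2 * n%:R * (`|k| + 1) + 1.
  have L0 : 0 < L by rewrite ltr_wpDl// mulr_ge0// addr_ge0.
  apply: (@negligible_curve _ _ L) => // a b _ _.
  rewrite prod_normE ge_max /=; apply/andP; split.
    have -> : s + k * ((2 * a - 1) * n%:R) - (s + k * ((2 * b - 1) * n%:R)) =
       (k * (2 * n%:R)) * (a - b) by ring.
    rewrite normrM ler_wpM2r// normrM [`|2 * _|]ger0_norm ?mulr_ge0//.
    by rewrite /L mulrDr mulr1 mulrC -!addrA lerDl addr_ge0// mulr_ge0.
  have -> : (2 * a - 1) * n%:R - (2 * b - 1) * n%:R = (2 * n%:R) * (a - b) by ring.
  rewrite normrM ler_wpM2r// [`|2 * _|]ger0_norm ?mulr_ge0//.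
  by rewrite /L mulrDr mulr1 addrAC lerDr addr_ge0// mulr_ge0// mulr_ge0.
apply: negligibleS (negligible_bigcup gn) => -[a b] /= ->.
have [n hn] : exists n : nat, `|b| < n%:R.
  by exists (Num.trunc `|b|).+1; have /andP[] := truncn_itv (normr_ge0 b).
exists n => //; have n0 : 0 < n%:R :> R by apply: le_lt_trans hn.
exists ((b / n%:R + 1) / 2) => /=.
  move: hn; rewrite ltr_norml in_itv/= => /andP[h1 h2].
  have : -1 <= b / n%:R <= 1.
    by rewrite ler_pdivlMr// ler_pdivrMr// mulN1r mul1r !ltW.
  by move=> /andP[? ?]; apply/andP; split; lra.
rewrite /g; have -> : (2 * ((b / n%:R + 1) / 2) - 1) * n%:R = b.
  by field; rewrite gt_eqF.
by [].
Qed.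

(** On a set of finite area 1 + |g|^2 is integrable, and it dominates |g|. *)
Lemma L2_integrable (U : set (pt R)) (g : pt R -> R) :
  measurable (U : set (mplane R)) -> (area U < +oo)%E ->
  L2 U g -> area.-integrable (U : set (mplane R)) (EFin \o g).
Proof.
move=> mU aU [mg ig].
have mg2 : measurable_fun (U : set (mplane R)) (fun x => `|g x| ^+ 2).
  by apply: measurable_funX; exact: measurableT_comp.
have i2 : area.-integrable (U : set (mplane R)) (EFin \o (fun x => `|g x| ^+ 2)).
  apply/integrableP; split; first exact/measurable_EFinP.
  apply: le_lt_trans ig; apply: ge0_le_integral => //.
  - by apply/measurableT_comp => //; exact/measurable_EFinP.
  - exact/measurable_EFinP.
  - by move=> x _; rewrite /= lee_fin normrX normr_id.
have i1 : area.-integrable (U : set (mplane R)) (EFin \o cst 1).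
  by apply: (integrable_bounded (C := 1)) => // x _; rewrite normr1.
have := integrableD mU i1 i2.
apply: le_integrable => //; first exact/measurable_EFinP.
move=> x Ux /=; rewrite lee_fin [leRHS]ger0_norm ?addr_ge0 ?exprn_ge0//.
move: (`|g x|) (normr_ge0 (g x)) => a a0.
have := sqr_ge0 (a - 1); nra.
Qed.

Lemma ae_eq0_integral (f : mplane R -> R) :
  measurable_fun setT f -> (forall x, 0 <= f x) ->
  (\int[area]_x (f x)%:E = 0)%E -> {ae area, forall x, f x = 0}.
Proof.
move=> mf f0 If.
have := @ae_eq_integral_abs _ _ R area setT measurableT (EFin \o f).
case; first exact/measurable_EFinP.
move=> + _; case.
  by rewrite -[RHS]If; apply: eq_integral => x _ /=; rewrite ger0_norm.
move=> N [mN N0 fN]; exists N; split => // x xf.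
by apply: fN => /(_ I) /= [].
Qed.

End AlmostEverywhere.

(** * The jump of a piecewise smooth function across a line *)

Section Jump.
Context {R : realType}.
Implicit Types (f g u : pt R -> R).

Lemma smooth_comp f (a b : pt R -> R) : smooth f -> smooth a -> smooth b ->
  smooth (fun x => f (a x, b x)).
Proof.
move=> sf sa sb; elim: sf => [c||
  |f1 f2 _ s1 _ s2|f1 f2 _ s1 _ s2|n f1 _ s1] //=.
- exact: smooth_cst.
- exact: smoothD.
- exact: smoothM.
- exact: (smooth_flat n s1).
Qed.

Lemma smooth_ext f g : f =1 g -> smooth f -> smooth g.
Proof. by move=> /funext ->. Qed.

Lemma smoothX f n : smooth f -> smooth (fun x => f x ^+ n).
Proof.
move=> sf; elim: n => [|n IH]; first exact: smooth_cst.
by apply: smooth_ext (smoothM sf IH) => x; rewrite exprS.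
Qed.

Lemma smooth_sum (I : Type) (r : seq I) (P : pred I) (F : I -> pt R -> R) :
  (forall i, P i -> smooth (F i)) ->
  smooth (fun x => \sum_(i <- r | P i) F i x).
Proof.
move=> sF; elim: r => [|i r IH].
  by apply: smooth_ext (smooth_cst 0) => x; rewrite big_nil.
have [Pi|Pi] := boolP (P i).
  by apply: smooth_ext (smoothD (sF i Pi) IH) => x; rewrite big_cons Pi.
by apply: smooth_ext IH => x; rewrite big_cons (negbTE Pi).
Qed.

Lemma Pk_smooth k f : Pk k f -> smooth f.
Proof.
move=> [c fE]; apply: smooth_ext (fun x => esym (fE x)) _.
apply: smooth_sum => i _; apply: smooth_sum => j _.
apply: smoothM; last exact: smoothX smooth_snd.
by apply: smoothM; [exact: smooth_cst|exact: smoothX smooth_fst].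
Qed.

Lemma compact_box (c : pt R) (r : R) : compact (box c r : set (pt R)).
Proof. by apply: compact_setX; exact: segment_compact. Qed.

Section JumpAcrossLine.
Variables (s k : R) (z0 : pt R) (pL pR : pt R -> R) (rho : R).
Hypotheses (spL : smooth pL) (spR : smooth pR) (rho0 : 0 < rho) (rho1 : rho <= 1).

(** The signed horizontal distance to the line x.1 = s + k x.2; [foot] is the horizontal projection
    onto that line, and [q] the difference of the two smooth pieces. *)
Let t (x : pt R) : R := x.1 - (s + k * x.2).
Let foot (x : pt R) : pt R := (s + k * x.2, x.2).
Let q (x : pt R) : R := pL x - pR x.
Let J (x : pt R) : R := q (foot x).
(** Positive on a sheared ellipse of horizontal half-width e around the line and vertical
    half-height rho around z0; only e will shrink. *)
Let arg (e : R) (x : pt R) : R := 1 - (t x / e) ^+ 2 - ((x.2 - z0.2) / rho) ^+ 2.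

(* The factor J, the jump itself, makes the trace below a square, so that the
   sign of the jump does not matter. *)
Definition bump (e : R) (x : pt R) : R := J x * flat 0 (arg e x).
Let phi := bump.

(** The jump of the discontinuous product on the line, continued constantly along horizontals. On
    the line t = 0, so [bump e] equals [bump 1] there and the trace is the same for every e. *)
Definition trace (x : pt R) : R := q (foot x) * phi 1 (foot x).

Let smoothN f : smooth f -> smooth (fun x => - f x).
Proof.
by move=> sf; apply: smooth_ext (smoothM (smooth_cst (-1)) sf) => x; rewrite mulN1r.
Qed.

Let smoothB f g : smooth f -> smooth g -> smooth (fun x => f x - g x).
Proof. by move=> sf sg; apply: smoothD => //; exact: smoothN. Qed.

Let st : smooth t.
Proof.
apply: smoothB; first exact: smooth_fst.
apply: smoothD; first exact: smooth_cst.
by apply: smoothM; [exact: smooth_cst|exact: smooth_snd].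
Qed.

Let sfoot f : smooth f -> smooth (fun x => f (foot x)).
Proof.
move=> sf; apply: smooth_comp => //; last exact: smooth_snd.
apply: smoothD; first exact: smooth_cst.
by apply: smoothM; [exact: smooth_cst|exact: smooth_snd].
Qed.

Let sq : smooth q. Proof. exact: smoothB. Qed.

Let sarg e : smooth (arg e).
Proof.
apply: smoothB; first apply: smoothB; first exact: smooth_cst.
  by apply: smoothX; apply: smoothM => //; exact: smooth_cst.
apply: smoothX; apply: smoothM; last exact: smooth_cst.
by apply: smoothB; [exact: smooth_snd|exact: smooth_cst].
Qed.

Lemma smooth_bump e : smooth (phi e).
Proof. by apply: smoothM; [exact: sfoot|exact: smooth_flat]. Qed.

Lemma smooth_trace : smooth trace.
Proof. by apply: (sfoot (f := fun x => q x * phi 1 x)); apply: smoothM => //; exact: smooth_bump. Qed.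

Let tfoot x : t (foot x) = 0. Proof. by rewrite /t /foot/= subrr. Qed.
Let Jfoot x : J (foot x) = J x. Proof. by []. Qed.

Let phi_foot e x : phi e (foot x) = phi 1 (foot x).
Proof. by rewrite /phi /bump /arg !tfoot !mul0r. Qed.

Lemma bump_neq0 e x : 0 < e -> phi e x != 0 ->
  `|t x| <= e /\ `|x.2 - z0.2| <= rho.
Proof.
move=> e0; rewrite /phi /bump mulf_eq0 negb_or => /andP[_].
have [a0|a0 _] := leP (arg e x) 0; first by rewrite flat_eq0 ?eqxx.
move: a0; rewrite /arg => a0.
have h (y d : R) : 0 < d -> (y / d) ^+ 2 <= 1 -> `|y| <= d.
  move=> d0; rewrite -real_normK ?num_real// expr_le1// normrM normfV (gtr0_norm d0).
  by rewrite ler_pdivrMr// mul1r.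
have h1 := sqr_ge0 (t x / e); have h2 := sqr_ge0 ((x.2 - z0.2) / rho).
by split; apply: h => //; lra.
Qed.

Lemma trace_ge0 x : 0 <= trace x.
Proof.
by rewrite /trace /phi /bump Jfoot mulrA -expr2 mulr_ge0 ?sqr_ge0 ?flat_ge0.
Qed.

Lemma trace_neq0 x : trace x != 0 -> `|x.2 - z0.2| <= rho.
Proof.
rewrite /trace mulf_eq0 negb_or => /andP[_ /(bump_neq0 ltr01)].
by case.
Qed.

(** From |x.2| <= |z0.2| + 1 and |x.1| <= |t x| + |s| + |k| |x.2| with |t x| <= 1. *)
Let M : R := `|s| + (`|k| + 1) * (`|z0.2| + 1) + 1.

Lemma bump_support_box x : `|t x| <= 1 -> `|x.2 - z0.2| <= rho ->
  box (0, 0) M x.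
Proof.
move=> tx xz; apply/box_norm; rewrite prod_normE ge_max.
have x2 : `|x.2| <= `|z0.2| + 1.
  rewrite -(subrK z0.2 x.2) (le_trans (ler_normD _ _))// addrC lerD2l.
  exact: le_trans rho1.
have h0 : 0 <= `|z0.2| + 1 by rewrite addr_ge0.
have kx : `|k * x.2| <= `|k| * (`|z0.2| + 1) by rewrite normrM ler_wpM2l.
have x1 : `|x.1| <= `|t x| + (`|s| + `|k * x.2|).
  have -> : x.1 = t x + (s + k * x.2) by rewrite /t subrK.
  by rewrite (le_trans (ler_normD _ _))// lerD2l ler_normD.
have ks := mulr_ge0 (normr_ge0 k) h0; have s0 := normr_ge0 s.
by rewrite /M mulrDl mul1r; apply/andP; split; lra.
Qed.

Let tcont : continuous t := smooth_continuous st.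

Let near_t (P : R -> bool) x : open [set a | P a] -> P (t x) ->
  \forall y \near x, P (t y).
Proof.
move=> oP Px; have h : nbhs (t x) [set a | P a] by apply: open_nbhs_nbhs.
exact: (@tcont x _ h).
Qed.

(* With u := pL on t < 0 and u := pR on t > 0, the function u * phi is
   discontinuous across t = 0; subtracting its jump times the ramp clip(t)
   makes it Lipschitz, whence the integral of its derivative vanishes. *)
Lemma jump_integral e (DL DR Dphi : pt R -> R) : 0 < e -> e <= 1 ->
  (forall x, is_derive x (edir 0) pL (DL x)) ->
  (forall x, is_derive x (edir 0) pR (DR x)) ->
  (forall x, is_derive x (edir 0) (phi e) (Dphi x)) ->
  continuous DL -> continuous DR -> continuous Dphi ->
  (\int[area]_x ((if (t x < 0)%R then DL x * phi e x + pL x * Dphi x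
     else DR x * phi e x + pR x * Dphi x) -
     (if (0 < t x < 1)%R then trace x else 0))%:E = 0)%E.
Proof.
move=> e0 e1 dL dR dphi cL cR cphi.
(* [kap] fixes the points left of the line and projects the others onto it, so q * phi composed with
   it is the full difference on the left and the trace on the right. [clip] is the ramp rising from
   0 at t = 0 to 1 at t = 1. *)
pose kap (x : pt R) : pt R := (s + k * x.2 + Num.min (t x) 0, x.2).
pose clip (x : pt R) : R := Num.min (t x) 1 - Num.min (t x) 0.
pose psi (x : pt R) : R :=
  q (kap x) * phi e (kap x) + pR x * phi e x - trace x * clip x.
have kapN x : t x <= 0 -> kap x = x.
  by move=> tx; rewrite /kap min_l// /t addrC subrK -surjective_pairing.
have kapP x : 0 <= t x -> kap x = foot x.
  by move=> tx; rewrite /kap min_r// addr0.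
have psiN x : t x <= 0 -> psi x = pL x * phi e x.
  move=> tx; rewrite /psi kapN// /clip !min_l//; last by rewrite (le_trans tx).
  by rewrite subrr mulr0 subr0 -mulrDl /q subrK.
have psi01 x : 0 <= t x <= 1 -> psi x = trace x + pR x * phi e x - trace x * t x.
  move=> /andP[t0 t1]; rewrite /psi kapP// /clip [Num.min _ 1]min_l// min_r// subr0.
  by rewrite phi_foot.
have psi1 x : 1 <= t x -> psi x = pR x * phi e x.
  move=> t1; have t0 : 0 <= t x by rewrite (le_trans _ t1).
  rewrite /psi kapP// /clip !min_r// subr0 phi_foot mulr1 /trace.
  by rewrite addrAC subrr add0r.
have psi0 x : ~ (box (0, 0) M : set (pt R)) x -> psi x = 0.
  move=> nx.
  have nE y : y.2 = x.2 -> ~ (`|x.2 - z0.2| <= rho) -> phi e y = 0.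
    move=> yx nxz; apply/eqP; apply: contraPT nxz => /(bump_neq0 e0)[_].
    by rewrite yx => h; apply.
  have [xz|xz] := pselect (`|x.2 - z0.2| <= rho); last first.
    have -> : psi x = q (kap x) * phi e (kap x) + pR x * phi e x - trace x * clip x by [].
    rewrite (nE (kap x))// (nE x)// !mulr0 addr0 sub0r.
    have -> : trace x = 0 by rewrite /trace -(phi_foot e) nE// mulr0.
    by rewrite mul0r oppr0.
  have tx : 1 < `|t x|.
    by rewrite ltNge; apply/negP => tx; apply: nx; exact: bump_support_box.
  have ph0 : phi e x = 0.
    apply/eqP; apply: contraTT tx => /(bump_neq0 e0)[tx _].
    by rewrite -leNgt (le_trans tx).
  move: tx; rewrite ltr_normr => /orP[tx|tx].
    by rewrite psi1 ?ph0 ?mulr0// ltW.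
  by rewrite psiN ?ph0 ?mulr0//; lra.
have psil z : loclip psi z.
  have lt : loclip t z by exact: smooth_loclip.
  have lk : loclip (fun x => (kap x).1) z.
    apply: loclipD; last by apply: loclip_min => //; exact: loclip_cst.
    apply: loclipD; first exact: loclip_cst.
    by apply: loclipM; [exact: loclip_cst|exact: loclip_snd].
  apply: loclipB; first apply: loclipD.
  - apply: (@loclip_comp _ (fun x => q x * phi e x) kap) => //.
      exact: loclip_snd.
    by apply: smooth_loclip; apply: smoothM => //; exact: smooth_bump.
  - by apply: smooth_loclip; apply: smoothM => //; exact: smooth_bump.
  - apply: loclipM; first exact: smooth_loclip smooth_trace.
    by apply: loclipB; apply: loclip_min => //; exact: loclip_cst.
have dtrace x : is_derive x (edir 0) trace 0.
  apply/is_derive_line0.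
  rewrite (_ : (fun _ => _) = cst (trace x)); first exact: is_derive_cst.
  by apply/funext => a; rewrite /trace /foot /edir /= scaler0 addr0.
have dt x : is_derive x (edir 0) t 1.
  apply/is_derive_line0.
  rewrite (_ : (fun _ => _) = fun a => a + t x).
    by apply: is_derive_eq; rewrite addr0.
  by apply/funext => a; rewrite /t /edir /= scaler0 addr0 [a *: 1]mulr1; ring.
pose H x : R := (if t x < 0 then DL x * phi e x + pL x * Dphi x
     else DR x * phi e x + pR x * Dphi x) - (if 0 < t x < 1 then trace x else 0).
(* The kinks of psi lie on the two null lines t = 0 and t = 1; elsewhere psi is locally one of three
   smooth expressions. *)
have dpsi : {ae area, forall x : mplane R, derivable psi x (edir 0) /\
    'D_(edir 0) psi x = H x}.
  have := negligibleU (negligible_line s k) (negligible_line (s + 1) k).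
  apply: negligibleS => x /= nx.
  have [tx|tx] := eqVneq (t x) 0; first by left; move/eqP: tx; rewrite subr_eq0 => /eqP.
  have [tx'|tx'] := eqVneq (t x) 1.
    by right; have := subrK (s + k * x.2) x.1; rewrite -/(t x) tx' => <-; ring.
  exfalso; apply: nx.
  suff : is_derive x (edir 0) psi (H x) by case.
  have [t0|t0] := ltP (t x) 0.
    have hn : \forall y \near x, pL y * phi e y = psi y.
      have := near_t (P := fun a => a < 0) (@open_lt _ _) t0.
      by apply: filterS => y /ltW /psiN ->.
    apply: near_eq_is_derive hn _; apply: is_derive_eq (is_deriveM (dL x) (dphi x)) _.
    rewrite /H t0 ltNge (ltW t0)/= subr0 addrC; congr (_ + _).
    by rewrite mulrC.
  have {tx}t0 : 0 < t x by rewrite lt_neqAle eq_sym tx.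
  have [t1|t1] := ltP (t x) 1.
    have hn : \forall y \near x, trace y + pR y * phi e y - trace y * t y = psi y.
      have := near_t (P := fun a => 0 < a) (@open_gt _ _) t0.
      have := near_t (P := fun a => a < 1) (@open_lt _ _) t1.
      by apply: filterS2 => y y1 y0; rewrite psi01// !ltW.
    apply: near_eq_is_derive hn _.
    apply: is_derive_eq (is_deriveB (is_deriveD (dtrace x) (is_deriveM (dR x) (dphi x)))
      (is_deriveM (dtrace x) (dt x))) _.
    rewrite /H t0 t1 ltNge (ltW t0)/= /GRing.scale/=; ring.
  have {tx'}t1 : 1 < t x by rewrite lt_neqAle eq_sym tx'.
  have hn : \forall y \near x, pR y * phi e y = psi y.
    have := near_t (P := fun a => 1 < a) (@open_gt _ _) t1.
    by apply: filterS => y /ltW /psi1 ->.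
  apply: near_eq_is_derive hn _; apply: is_derive_eq (is_deriveM (dR x) (dphi x)) _.
  rewrite /H t0 [_ < 1]ltNge [_ < 0]ltNge (ltW t0) (ltW t1)/= subr0 addrC; congr (_ + _).
  by rewrite mulrC.
have mt := measurable_fun_continuous tcont.
have mH : measurable_fun (setT : set (mplane R)) H.
  have ms f : smooth f -> measurable_fun (setT : set (mplane R)) f.
    by move=> /smooth_continuous; exact: measurable_fun_continuous.
  have mb := ms _ (smooth_bump e).
  have mL := measurable_fun_continuous cL; have mR := measurable_fun_continuous cR.
  have mp := measurable_fun_continuous cphi.
  apply: measurable_funB; apply: measurable_fun_ifT.
  - exact: measurable_fun_ltr.
  - by apply: measurable_funD; apply: measurable_funM => //; exact: ms.
  - by apply: measurable_funD; apply: measurable_funM => //; exact: ms.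
  - by apply: measurable_and; exact: measurable_fun_ltr.
  - exact: ms smooth_trace.
  - exact: measurable_cst.
by have [_] := integral_derive0 (@compact_box (0, 0) M) psi0 psil mH dpsi.
Qed.

End JumpAcrossLine.
End Jump.

(** * An H^1 function has no jump *)

Section JumpZero.
Context {R : realType}.

Lemma Rintegral_support (A B : set (mplane R)) (f : mplane R -> R) :
  A `<=` B -> (forall x, ~ A x -> f x = 0) ->
  \int[area]_(x in B) f x = \int[area]_(x in A) f x.
Proof.
move=> AB f0; rewrite !(Rintegral_mkcond _ _ f).
congr Rintegral; apply/funext => x; rewrite !patchE.
have [/set_mem xA|/negP xA] := boolP (x \in A).
  by rewrite mem_set//; exact: AB.
by case: ifP => // _; apply: f0 => Ax; apply: xA; exact: mem_set.
Qed.

Lemma cvg_Rintegral0 (K : set (mplane R)) (h : mplane R -> R)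
    (phi : nat -> mplane R -> R) (B : R) : measurable K ->
  area.-integrable K (EFin \o h) ->
  (forall n, measurable_fun K (phi n)) -> (forall n x, K x -> `|phi n x| <= B) ->
  {ae area, forall x, K x -> phi n x @[n --> \oo] --> (0 : R)} ->
  \int[area]_(x in K) (h x * phi n x) @[n --> \oo] --> (0 : R).
Proof.
move=> mK hi mphi phiB phi0.
have /measurable_int/measurable_EFinP mh := hi.
have mf n : measurable_fun K (EFin \o (fun x => h x * phi n x)).
  by apply/measurable_EFinP; exact: measurable_funM.
have m0 : measurable_fun K (EFin \o (fun _ : mplane R => 0 : R)).
  by apply/measurable_EFinP; exact: measurable_cst.
have hB : area.-integrable K (EFin \o (fun x => B * `|h x|)).
  rewrite (_ : _ \o _ = fun x => (B%:E * (abse \o (EFin \o h)) x)%E).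
    by apply: integrableZl => //; exact: integrable_abse.
  by apply/funext => x /=; rewrite EFinM.
have cv : {ae area, forall x, K x ->
    (EFin \o (fun x => h x * phi n x)) x @[n --> \oo] --> (EFin \o (fun _ => 0 : R)) x}.
  apply: filterS phi0 => x Hx Kx; apply: cvg_EFin; first exact: nearW.
  by have := cvgM (cvg_cst (h x)) (Hx Kx); rewrite mulr0; exact.
have dom : {ae area, forall x n, K x ->
    (`|(EFin \o (fun x => h x * phi n x)%R) x| <= (EFin \o (fun x => B * `|h x|)%R) x)%E}.
  apply: aeW => x n Kx; rewrite /= lee_fin normrM mulrC ler_wpM2r//.
  exact: phiB.
have [_ _ cI] := dominated_convergence mK mf m0 cv hB dom.
have I0 : (\int[area]_(x in K) (EFin \o (fun _ => 0%R : R)) x = 0)%E.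
  by apply: integral0_eq.
rewrite I0 in cI.
by apply: (fine_cvg cI).
Qed.

(* The integral of trace over the strip 0 < t < 1 does not depend on e, and it
   equals an integral of an L1 function against bump e, which tends to 0. *)
Lemma jump_zero (U : set (pt R)) (u g : pt R -> R) (s k : R) (z0 : pt R)
    (pL pR : pt R -> R) (r : R) :
  open U -> (area U < +oo)%E -> L2 U u -> L2 U g -> weak_partial U 0 u g ->
  smooth pL -> smooth pR -> 0 < r -> ball z0 r `<=` U ->
  (forall x, ball z0 r x -> x.1 < s + k * x.2 -> u x = pL x) ->
  (forall x, ball z0 r x -> s + k * x.2 < x.1 -> u x = pR x) ->
  z0.1 = s + k * z0.2 -> pL z0 = pR z0.
Proof.
move=> oU aU [mu _] L2g wug spL spR r0 rU uL uR z0E.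
have mU := measurable_open oU.
pose t (x : pt R) : R := x.1 - (s + k * x.2).
(* On the support |t| <= e <= rho and |x.2 - z0.2| <= rho, hence |x.1 - z0.1| <= rho (1 + |k|) <=
   r/2: every bump lives in the box K inside the given ball. *)
pose rho : R := Num.min 1 (r / (2 * (`|k| + 1))).
have k1 : 0 < `|k| + 1 by rewrite ltr_wpDl.
have rho0 : 0 < rho by rewrite lt_min ltr01 divr_gt0// mulr_gt0.
have rho1 : rho <= 1 by rewrite ge_min lexx.
have rhor : rho * (`|k| + 1) <= r / 2.
  have : rho <= r / (2 * (`|k| + 1)) by rewrite ge_min lexx orbT.
  by rewrite ler_pdivlMr ?mulr_gt0//; lra.
pose e n : R := rho * harm 0 n.
have e0 n : 0 < e n by rewrite mulr_gt0// harm_gt0.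
have erho n : e n <= rho.
  by rewrite /e ler_piMr ?(ltW rho0)//; have := @harm_le R 0 n; rewrite invr1.
have e1 n : e n <= 1 by apply: le_trans rho1.
pose phi n := bump s k z0 pL pR rho (e n).
have sphi n : smooth (phi n) by exact: smooth_bump.
pose K : set (mplane R) := box z0 (r / 2).
have cK : compact (K : set (pt R)) := @compact_box _ z0 (r / 2).
have mK : measurable K := measurable_box z0 (r / 2).
have aK : (area K < +oo)%E by rewrite area_box ?ltry//; lra.
have Kball : K `<=` ball z0 r.
  move=> x [/= + +]; rewrite !in_itv/= => /andP[? ?] /andP[? ?].
  by split; rewrite /ball/= ltr_distl; apply/andP; split; lra.
have KU : K `<=` U by move=> x /Kball; exact: rU.
have phiK n x : ~ K x -> phi n x = 0.
  move=> nK; apply/eqP; apply: contraPT nK => /(bump_neq0 rho0 (e0 n))[tx xz].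
  have /= {}tx : `|x.1 - (s + k * x.2)| <= rho by apply: le_trans (erho n).
  have x1 : `|x.1 - z0.1| <= r / 2.
    have -> : x.1 - z0.1 = (x.1 - (s + k * x.2)) + k * (x.2 - z0.2) by rewrite z0E; ring.
    rewrite (le_trans (ler_normD _ _))// (le_trans _ rhor)// [leRHS]mulrDr mulr1 addrC lerD//.
    by rewrite normrM mulrC ler_wpM2r.
  have x2 : `|x.2 - z0.2| <= r / 2.
    rewrite (le_trans xz)// (le_trans _ rhor)// ler_peMr ?(ltW rho0)//.
    by rewrite lerDr.
  by apply; split => /=; rewrite in_itv/= -ler_distl.
have [DL sDL dL] := smooth_derive (edir 0) spL.
have [DR sDR dR] := smooth_derive (edir 0) spR.
have [Dphi Dphi_] : exists Dphi : nat -> pt R -> R, forall n,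
    smooth (Dphi n) /\ forall x, is_derive x (edir 0) (phi n) (Dphi n x).
  have /choice[D HD] n : exists D, smooth D /\ forall x, is_derive x (edir 0) (phi n) (D x).
    by have [D sD dD] := smooth_derive (edir 0) (sphi n); exists D.
  by exists D.
have sD n := (Dphi_ n).1; have dD n := (Dphi_ n).2.
have nK x : ~ K x -> \forall y \near x, ~ K y.
  move=> Kx; have : open (~` K : set (pt R)).
    by apply: closed_openC; apply: compact_closed => //; exact: norm_hausdorff.
  by rewrite openE => /(_ x Kx).
have DphiK n x : ~ K x -> Dphi n x = 0.
  move=> /nK Kx; have <- : 'D_(edir 0) (phi n) x = Dphi n x by have [] := dD n x.
  by apply: (derivable_eq0_near _ _).2; apply: filterS Kx => y; exact: phiK.
have ms f : smooth f -> measurable_fun (setT : set (mplane R)) f.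
  by move=> /smooth_continuous; exact: measurable_fun_continuous.
have msK f : smooth f -> measurable_fun K f by move=> /ms; exact: measurable_funS.
have bnd f : smooth f -> exists2 B : R, 0 < B & forall x, K x -> `|f x| <= B.
  by move=> /smooth_continuous cf; apply: continuous_compact_bounded => // x _; exact: cf.
have tc : continuous t.
  move=> x; apply: cvgB; first exact: cvg_fst.
  by apply: cvgD; [exact: cvg_cst|apply: cvgM; [exact: cvg_cst|exact: cvg_snd]].
have mt := measurable_fun_continuous tc.
have mtl : measurable_fun (setT : set (mplane R)) (fun x => t x < 0).
  exact: measurable_fun_ltr.
pose V (x : mplane R) : R := if t x < 0 then DL x else DR x.
pose P (x : mplane R) : R := if t x < 0 then pL x else pR x.
have iK (f1 f2 : pt R -> R) : smooth f1 -> smooth f2 ->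
    area.-integrable K (EFin \o (fun x => if t x < 0 then f1 x else f2 x)).
  move=> s1 s2; have [B1 B10 h1] := bnd _ s1; have [B2 B20 h2] := bnd _ s2.
  apply: (integrable_bounded (C := B1 + B2)) => //.
    apply: measurable_funS measurableT _ _ => //.
    by apply: measurable_fun_ifT => //; exact: ms.
  move=> x Kx; case: ifP => _; first by rewrite (le_trans (h1 x Kx))// lerDl ltW.
  by rewrite (le_trans (h2 x Kx))// lerDr ltW.
pose tr := trace s k z0 pL pR rho.
pose strip (x : mplane R) : R := if 0 < t x < 1 then tr x else 0.
have str : smooth tr by exact: smooth_trace.
have strip_ge0 x : 0 <= strip x by rewrite /strip; case: ifP => // _; exact: trace_ge0.
have mstrip : measurable_fun (setT : set (mplane R)) strip.
  apply: measurable_fun_ifT => //; last exact: ms.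
  by apply: measurable_and; exact: measurable_fun_ltr.
pose M : R := `|s| + (`|k| + 1) * (`|z0.2| + 1) + 1.
have strip0 x : M < `|x| -> strip x = 0.
  rewrite /strip => Mx; case: ifP => // /andP[t0 t1]; apply/eqP.
  apply: contraTT Mx => /(trace_neq0 rho0) xz; rewrite -leNgt; apply/box_norm.
  by apply: (bump_support_box rho1) => //; rewrite ger0_norm ltW.
have istrip : area.-integrable (setT : set (mplane R)) (EFin \o strip).
  have [|B B0 hB] := @continuous_compact_bounded R (box (0, 0) M) tr (@compact_box _ (0, 0) M).
    by move=> x _; exact: smooth_continuous.
  apply: (integrable_bounded_support (C := B) (r := M)) => // x.
  have [Mx|Mx] := ltP M `|x|; first by rewrite strip0// normr0 ltW.
  rewrite /strip; case: ifP => _; last by rewrite normr0 ltW.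
  by apply: hB; apply/box_norm.
pose A n (x : mplane R) : R := if t x < 0 then DL x * phi n x + pL x * Dphi n x
  else DR x * phi n x + pR x * Dphi n x.
have AE n x : A n x = V x * phi n x + P x * Dphi n x.
  by rewrite /A /V /P; case: ifP.
have A0 n x : ~ K x -> A n x = 0.
  by move=> Kx; rewrite AE phiK// DphiK// !mulr0 addr0.
have iA n : area.-integrable K (EFin \o A n).
  by apply: iK; apply: smoothD; apply: smoothM.
have iVphi n : area.-integrable K (EFin \o (fun x => V x * phi n x)).
  rewrite (_ : (fun x => _) = fun x => if t x < 0 then DL x * phi n x else DR x * phi n x).
    by apply: iK; apply: smoothM.
  by apply/funext => x; rewrite /V; case: ifP.
have iPD n : area.-integrable K (EFin \o (fun x => P x * Dphi n x)).
  rewrite (_ : (fun x => _) = fun x => if t x < 0 then pL x * Dphi n x else pR x * Dphi n x).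
    by apply: iK; apply: smoothM.
  by apply/funext => x; rewrite /P; case: ifP.
have iAT n : area.-integrable (setT : set (mplane R)) (EFin \o A n).
  have /(integrable_mkcond _ mK) := iA n; congr (integrable _ _ _).
  apply/funext => x; rewrite patchE; case: ifPn => // /negP Kx /=.
  by rewrite A0// => /mem_set.
pose c := \int[area]_x strip x.
have cA n : \int[area]_(x in K) A n x = c.
  rewrite -(Rintegral_support (@subsetT _ K) (A0 n)).
  apply/eqP; rewrite -subr_eq0 /c -RintegralB//; apply/eqP.
  have := jump_integral (z0 := z0) spL spR rho0 rho1 (e0 n) (e1 n) dL dR (dD n)
    (smooth_continuous sDL) (smooth_continuous sDR) (smooth_continuous (sD n)).
  exact: (congr1 fine).
have ig := L2_integrable mU aU L2g.
have igK : area.-integrable K (EFin \o g) by exact: integrableS ig.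
have sfoot : smooth (fun x => s + k * x.2).
  by apply: smoothD; [exact: smooth_cst|apply: smoothM; [exact: smooth_cst|exact: smooth_snd]].
have [B B0 JB] := bnd _ (smoothD (smooth_comp spL sfoot (smooth_snd))
  (smoothM (smooth_cst (-1)) (smooth_comp spR sfoot (smooth_snd)))).
have phiB n x : K x -> `|phi n x| <= B.
  move=> Kx; rewrite /phi /bump normrM; apply: le_trans (JB x Kx); rewrite mulN1r.
  by rewrite ler_piMr// ger0_norm ?flat_ge0 ?flat0_le1.
have igphi n : area.-integrable K (EFin \o (fun x => g x * phi n x)).
  have gB : area.-integrable K (fun x => (B%:E * (abse \o (EFin \o g)) x)%E).
    by apply: integrableZl => //; exact: integrable_abse.
  apply: le_integrable gB => //.
    apply/measurable_EFinP; apply: measurable_funM; last exact: msK.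
    by apply/measurable_EFinP; exact: measurable_int igK.
  move=> x Kx; rewrite /= lee_fin normrM [leRHS]normrM normr_id mulrC.
  by rewrite ler_wpM2r// (le_trans (phiB n x Kx))// ler_norm.
have muK : measurable_fun K u by exact: measurable_funS mu.
have PDE n : \int[area]_(x in K) (P x * Dphi n x) =
    - \int[area]_(x in K) (g x * phi n x).
  have tphi : test_function U (phi n).
    split; first by move=> m; exact: smooth_Ck.
    by exists K; split => // x; exact: phiK.
  have := wug _ tphi.
  rewrite (Rintegral_support KU); last first.
    move=> x Kx; have -> : 'D_(edir 0) (phi n) x = Dphi n x by have [] := dD n x.
    by rewrite DphiK// mulr0.
  rewrite (Rintegral_support KU); last by move=> x Kx; rewrite phiK// mulr0.
  move=> <-; rewrite /Rintegral; congr fine.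
  apply: ae_eq_integral => //.
  - by have /measurable_int := iPD n.
  - apply/measurable_EFinP; apply: measurable_funM => //.
    rewrite (_ : 'D_(edir 0) (phi n) = Dphi n); first exact: msK.
    by apply/funext => x; have [] := dD n x.
  - apply: negligibleS (negligible_line s k) => x /= nx.
    apply: contrapT => xl; apply: nx => Kx; congr EFin.
    have -> : 'D_(edir 0) (phi n) x = Dphi n x by have [] := dD n x.
    congr (_ * _); rewrite /P /t subr_lt0.
    have [xlt|xgt|//] := ltgtP x.1 (s + k * x.2).
      by rewrite uL//; exact: Kball.
    by rewrite uR//; exact: Kball.
have cE n : c = \int[area]_(x in K) (V x * phi n x) - \int[area]_(x in K) (g x * phi n x).
  rewrite -PDE -RintegralD// -(cA n).
  by apply: eq_Rintegral => x _; exact: AE.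
have phi_cvg : {ae area, forall x, K x -> phi n x @[n --> \oo] --> (0 : R)}.
  apply: negligibleS (negligible_line s k) => x /= nx.
  apply: contrapT => xl; apply: nx => Kx.
  have tx : 0 < `|t x| by rewrite normr_gt0 subr_eq0; exact/eqP.
  apply: cvg_near_cst; near=> n.
  apply/eqP; apply: contraT => /(bump_neq0 rho0 (e0 n))[/= txe _].
  have : e n < `|t x|.
    rewrite /e mulrC -ltr_pdivlMr//; near: n.
    have := @cvg_harm R 0 => /cvgrPdist_lt/(_ _ (divr_gt0 tx rho0)); apply: filterS => n.
    by rewrite sub0r normrN gtr0_norm// harm_gt0.
  by rewrite ltNge txe.
have c0 : c = 0.
  have iV : area.-integrable K (EFin \o V) by exact: iK.
  have cV := cvg_Rintegral0 mK iV (fun n => msK _ (sphi n)) phiB phi_cvg.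
  have cg := cvg_Rintegral0 mK igK (fun n => msK _ (sphi n)) phiB phi_cvg.
  have := cvgB cV cg; rewrite subr0 => h.
  have hc : (fun _ : nat => c) @ \oo --> (0 : R) by rewrite (funext cE); exact: h.
  by apply: (cvg_unique _ (cvg_cst c) hc).
(* A nonnegative function with zero integral. Its sign is where the factor J of the bump pays
   off. *)
have st0 : {ae area, forall x, strip x = 0}.
  apply: ae_eq0_integral => //.
  have : (fine (\int[area]_x (strip x)%:E))%:E = 0%E by rewrite -[fine _]/c c0.
  by rewrite fineK//; exact: (integrable_fin_num measurableT istrip).
apply/eqP; rewrite -subr_eq0; apply: contraT => q0; exfalso.
have z0foot : (s + k * z0.2, z0.2) = z0 by rewrite -z0E -surjective_pairing.
have tz0 : 0 < tr z0.
  rewrite /tr /trace /bump /= z0foot !subrr !mul0r expr0n/= !subr0.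
  rewrite mulrA mulr_gt0 ?flat_gt0//.
  by rewrite -expr2 exprn_even_gt0.
have near_gt (f : pt R -> R) x a : continuous f -> a < f x ->
    \forall y \near x, a < f y.
  move=> cf ax; have h : nbhs (f x) [set b | a < b].
    by apply: open_nbhs_nbhs; split => //; exact: open_gt.
  exact: (cf x _ h).
have near_lt (f : pt R -> R) x a : continuous f -> f x < a ->
    \forall y \near x, f y < a.
  move=> cf ax; have h : nbhs (f x) [set b | b < a].
    by apply: open_nbhs_nbhs; split => //; exact: open_lt.
  exact: (cf x _ h).
have ctr : continuous tr := smooth_continuous str.
have [d d0 dtr] : exists2 d : R, 0 < d & forall x, ball z0 d x -> 0 < tr x.
  have : \forall x \near z0, 0 < tr x.
    exact: near_gt.
  by move=> /nbhs_ballP[d /= ? ?]; exists d.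
pose d' := Num.min d 1.
have d'0 : 0 < d' by rewrite lt_min d0 ltr01.
have [d'd d'1] : d' <= d /\ d' <= 1 by rewrite !ge_min !lexx orbT.
(* At z0 itself t = 0 and [strip] vanishes by definition, so the contradiction is sought slightly to
   the right: d' <= 1 puts z1 inside the strip, d' <= d keeps the trace positive there. *)
pose z1 : pt R := (z0.1 + d' / 2, z0.2).
have trz1 : 0 < tr z1.
  apply: dtr; split; rewrite /ball/=; last by rewrite subrr normr0.
  by rewrite opprD addrA subrr sub0r normrN ger0_norm; lra.
have tz1 : 0 < t z1 < 1.
  by rewrite /t /= z0E addrAC subrr add0r; apply/andP; split; lra.
have : \forall y \near z1, 0 < strip y.
  move: tz1 => /andP[t0 t1]; near=> y.
  rewrite /strip ifT; last first.
    apply/andP; split; near: y.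
      exact: near_gt.
    exact: near_lt.
  by near: y; exact: near_gt.
move=> /nbhs_ballP[a /= a0 ha].
have [x /ha + stx] := ae_ball z1 a0 st0.
by rewrite stx ltxx.
Unshelve. all: by end_near. Qed.

End JumpZero.

(** * Piecewise quadratic interpolation on the split *)

Section Interpolation.
Context {R : realType}.
Implicit Types (x : pt R) (i j k l : 'I_3) (a b c : option 'I_3) (val : pt R -> R).

(** The barycentric coordinates of the reference triangle, as affine functions on the whole
    plane. *)
Definition lam i x : R := tnth [tuple x.1; x.2; 1 - x.1 - x.2] i.

Definition minlam x : R := Num.min (lam 0 x) (Num.min (lam 1 x) (lam 2 x)).

(* None stands for the barycenter *)
Definition vert a : pt R := if a is Some i then ref_vertex i else barycenter.

(** The piecewise affine nodal basis of the split: on the subtriangle opposite vertex k the minimum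
    is [lam k]. Writing it with a minimum avoids any gluing along the edges. *)
Definition hat a x : R := if a is Some i then lam i x - minlam x else 3 * minlam x.

Definition mid a b : pt R := 2^-1 *: (vert a + vert b).

(* The P2 Lagrange basis on the split is hat a * (2 * hat a - 1) at the vertices
   and 4 * hat a * hat b at the midpoints; the latter come twice here, as the
   pairs (a, b) and (b, a). *)
Definition sint val x : R :=
  \sum_a \sum_b 2 * hat a x * hat b x * val (mid a b) - \sum_a hat a x * val (mid a a).

(** [cell k] and [ccell k] are the open and the closed subtriangle opposite vertex k. *)
Definition cell k x : Prop := 0 < lam k x /\ forall l, l != k -> lam k x < lam l x.

Definition ccell k x : Prop := 0 <= lam k x /\ forall l, lam k x <= lam l x.

Lemma ord3P (P : 'I_3 -> Prop) : P 0 -> P 1 -> P 2 -> forall i, P i.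
Proof.
move=> P0 P1 P2 [[|[|[|//]]] Hi].
- by rewrite (_ : Ordinal Hi = 0)//; exact/val_inj.
- by rewrite (_ : Ordinal Hi = 1)//; exact/val_inj.
- by rewrite (_ : Ordinal Hi = 2)//; exact/val_inj.
Qed.

Lemma sum_opt3 (F : option 'I_3 -> R) :
  \sum_a F a = F None + F (Some 0) + F (Some 1) + F (Some 2).
Proof.
rewrite (bigD1 None)//= (reindex_onto Some (odflt ord0)) /=; last by case.
rewrite (eq_bigl xpredT) => [|i]; last by rewrite eqxx.
rewrite !big_ord_recl big_ord0 /= addr0 -!addrA.
by congr (_ + (F (Some _) + (F (Some _) + F (Some _)))); apply/val_inj.
Qed.

Lemma lam_vertex i j : lam i (ref_vertex j : pt R) = (i == j)%:R.
Proof.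
elim/ord3P: i; elim/ord3P: j; rewrite /lam /ref_vertex !(tnth_nth 0)/=.
all: by rewrite /=; lra.
Qed.

Lemma barycenterE : barycenter = (3^-1, 3^-1) :> pt R.
Proof.
rewrite /barycenter !big_ord_recl big_ord0 /ref_vertex !(tnth_nth 0)/=.
by congr (_, _); rewrite /= /GRing.scale/=; field.
Qed.

Lemma vertE a : vert a = (if a is Some i then ((i == 0)%:R, (i == 1)%:R) else (3^-1, 3^-1)).
Proof.
case: a => [i|/=]; last exact: barycenterE.
by elim/ord3P: i; rewrite /= /ref_vertex (tnth_nth 0).
Qed.

Lemma lam_sum x : lam 0 x + lam 1 x + lam 2 x = 1.
Proof. by rewrite /lam !(tnth_nth 0)/=; ring. Qed.

Lemma lam0 x : lam 0 x = x.1. Proof. by rewrite /lam (tnth_nth 0). Qed.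
Lemma lam1 x : lam 1 x = x.2. Proof. by rewrite /lam (tnth_nth 0). Qed.
Lemma lam2 x : lam 2 x = 1 - x.1 - x.2. Proof. by rewrite /lam (tnth_nth 0). Qed.
Definition lamE := (lam0, lam1, lam2).

Lemma lam_affine i x y (t : R) :
  lam i ((1 - t) *: x + t *: y) = (1 - t) * lam i x + t * lam i y.
Proof. by elim/ord3P: i; rewrite !lamE /= /GRing.scale/=; ring. Qed.

Lemma minlam_le i x : minlam x <= lam i x.
Proof.
by elim/ord3P: i; rewrite /minlam !ge_min lexx ?orbT.
Qed.

Lemma minlamE k x : (forall l, lam k x <= lam l x) -> minlam x = lam k x.
Proof.
move=> H; apply/eqP; rewrite eq_le minlam_le /=.
by rewrite /minlam !le_min !H.
Qed.

Lemma minlam_ex x : exists k, forall l, lam k x <= lam l x.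
Proof.
have := minlam_le ^~ x; rewrite {1}/minlam.
rewrite /Num.min; case: ifP => _; last case: ifP => _; move=> H.
- by exists 0.
- by exists 1.
- by exists 2.
Qed.

Lemma hat_sum x : \sum_a hat a x = 1.
Proof. by rewrite sum_opt3 /= -[RHS](lam_sum x); ring. Qed.

Lemma hat_vert x : x.1 = \sum_a hat a x * (vert a).1 /\
  x.2 = \sum_a hat a x * (vert a).2.
Proof.
rewrite !sum_opt3 !vertE /= !lamE; split; first by field.
by field.
Qed.

Lemma midC a b : mid a b = mid b a. Proof. by rewrite /mid addrC. Qed.

Lemma mid_id a : mid a a = vert a.
Proof.
rewrite /mid; case: (vert a) => p q; congr (_, _); rewrite /= /GRing.scale/=.
  by field.
by field.
Qed.

Lemma lam_mid i a b : lam i (mid a b) = (lam i (vert a) + lam i (vert b)) / 2.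
Proof.
have half : 1 - 2^-1 = 2^-1 :> R by field.
have -> : mid a b = (1 - 2^-1) *: vert a + 2^-1 *: vert b by rewrite /mid scalerDr half.
by rewrite lam_affine; field.
Qed.

Lemma lam_bary i : lam i barycenter = 3^-1.
Proof. by rewrite barycenterE; elim/ord3P: i; rewrite lamE//=; field. Qed.

Lemma lam_vert_le k l a : a != Some k -> lam k (vert a) <= lam l (vert a).
Proof.
case: a => [i|_] /=; last by rewrite !lam_bary.
rewrite !lam_vertex => ik; have -> : (k == i) = false.
  by apply: contra_neqF ik => /eqP ->.
by case: (l == i).
Qed.

Lemma hat_node c a b : hat c (mid a b) = ((c == a)%:R + (c == b)%:R) / 2.
Proof.
(* Two vertices of the split cannot use up all three corners, so both lie in the closed subtriangle
   opposite some corner k. The hats are affine there, whence their value at the midpoint is the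
   average of their values at the ends. *)
have [k [ka kb]] : exists k, a != Some k /\ b != Some k.
  case: a => [i|]; case: b => [j|].
  - elim/ord3P: i; elim/ord3P: j; try (by exists 0); try (by exists 1); by exists 2.
  - by elim/ord3P: i; [exists 1|exists 0|exists 0].
  - by elim/ord3P: j; [exists 1|exists 0|exists 0].
  - by exists 0.
have hv d : d != Some k -> hat c (vert d) = (c == d)%:R.
  move=> dk; have m := minlamE (fun l => lam_vert_le l dk).
  rewrite /hat m; case: d dk {m} => [i|] dk /=.
    have ki : (k == i) = false by apply: contra_neqF dk => /eqP ->.
    case: c => [j|]; rewrite /= !lam_vertex ki /= ?subr0 ?mulr0//.
  case: c => [j|]; rewrite /= !lam_bary ?subrr//.
  by rewrite mulfV// pnatr_eq0.
have mm : minlam (mid a b) = (minlam (vert a) + minlam (vert b)) / 2.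
  rewrite (minlamE (fun l => lam_vert_le l ka)) (minlamE (fun l => lam_vert_le l kb)).
  rewrite -lam_mid; apply: minlamE => l; rewrite !lam_mid.
  by rewrite ler_wpM2r ?invr_ge0// lerD// lam_vert_le.
rewrite -(hv _ ka) -(hv _ kb) /hat mm; case: c {hv} => [j|].
  by rewrite lam_mid; field.
by field.
Qed.

(** At a node each hat is the average of two Kronecker deltas, which collapses the sums; the
    symmetry of [mid] recombines the two copies of a midpoint. *)
Lemma sint_node val a b : sint val (mid a b) = val (mid a b).
Proof.
pose d (a' b' : option 'I_3) : R := (a' == b')%:R.
have dsum (F : option 'I_3 -> R) e : \sum_c d c e * F c = F e.
  rewrite (bigD1 e)//= /d eqxx mul1r big1 ?addr0// => c /negbTE ->.
  by rewrite mul0r.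
rewrite /sint.
have -> : \sum_c hat c (mid a b) * val (mid c c) = (val (mid a a) + val (mid b b)) / 2.
  rewrite -(dsum (fun c => val (mid c c)) a) -(dsum (fun c => val (mid c c)) b).
  rewrite -big_split mulr_suml; apply: eq_bigr => c _ /=.
  by rewrite hat_node -/(d c a) -/(d c b); field.
have -> : \sum_c \sum_e 2 * hat c (mid a b) * hat e (mid a b) * val (mid c e) =
    (val (mid a a) + val (mid a b) + (val (mid a b) + val (mid b b))) / 2.
  have E c : \sum_e 2 * hat c (mid a b) * hat e (mid a b) * val (mid c e) =
      d c a * ((val (mid c a) + val (mid c b)) / 2) + d c b * ((val (mid c a) + val (mid c b)) / 2).
    rewrite -(dsum (fun e => val (mid c e)) a) -(dsum (fun e => val (mid c e)) b).
    rewrite -big_split -mulrDl mulr_suml mulr_sumr; apply: eq_bigr => e _ /=.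
    by rewrite !hat_node -/(d c a) -/(d c b) -/(d e a) -/(d e b); field.
  rewrite (eq_bigr _ (fun c _ => E c)) big_split /=.
  rewrite (dsum (fun c => (val (mid c a) + val (mid c b)) / 2)).
  by rewrite (dsum (fun c => (val (mid c a) + val (mid c b)) / 2)) (midC b a); field.
by field.
Qed.

Lemma sint_ext val val' x : (forall a b, val (mid a b) = val' (mid a b)) ->
  sint val x = sint val' x.
Proof.
move=> H; rewrite /sint; congr (_ - _).
  by apply: eq_bigr => a _; apply: eq_bigr => b _; rewrite H.
by apply: eq_bigr => a _; rewrite H.
Qed.

Lemma Pk2E (f : pt R -> R) : Pk 2 f <-> exists c : R * R * R * (R * R * R), forall x,
  f x = c.1.1.1 + c.1.1.2 * x.1 + c.1.2 * x.2 +
    c.2.1.1 * x.1 ^+ 2 + c.2.1.2 * (x.1 * x.2) + c.2.2 * x.2 ^+ 2.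
Proof.
split=> [[c fE]|[[[[c0 c1] c2] [[c3 c4] c5]] fE]].
  exists ((c 0%N 0%N, c 1%N 0%N, c 0%N 1%N), (c 2%N 0%N, c 1%N 1%N, c 0%N 2%N)) => x.
  rewrite fE /= !big_ord_recl !big_ord0 /=.
  do 3 rewrite ?big_mkcond/= ?big_ord_recl ?big_ord0/=.
  rewrite /bump/=; ring.
exists (fun i j : nat => if i is 0%N then if j is 0%N then c0 else if j is 1%N then c2 else c5
  else if i is 1%N then if j is 0%N then c1 else c4 else c3) => x.
rewrite fE /= !big_ord_recl !big_ord0 /=.
do 3 rewrite ?big_mkcond/= ?big_ord_recl ?big_ord0/=.
rewrite /bump/=; ring.
Qed.

(** Since x is the combination of the vertices with the hats as weights, and these sum to 1, this is
    a polynomial identity in three hat values, valid at every point of the plane. *)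
Lemma sint_Pk2 f x : Pk 2 f -> sint f x = f x.
Proof.
move=> /Pk2E[[[[c0 c1] c2] [[c3 c4] c5]] /= fE].
have [X Y] := hat_vert x.
have h := hat_sum x; rewrite sum_opt3 in h.
have {h}hN : hat None x = 1 - hat (Some 0) x - hat (Some 1) x - hat (Some 2) x.
  by rewrite -h; ring.
rewrite fE /sint !sum_opt3 !fE X Y !sum_opt3 hN.
move: (hat (Some 0) x) (hat (Some 1) x) (hat (Some 2) x) => u v w.
by rewrite /mid !vertE /= /GRing.scale/=; field.
Qed.

Definition affine (f : pt R -> R) := exists c : R * R * R, forall x,
  f x = c.1.1 + c.1.2 * x.1 + c.2 * x.2.

Lemma affine_lam i : affine (lam i).
Proof.
elim/ord3P: i.
- by exists (0, 1, 0) => x; rewrite lamE /=; ring.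
- by exists (0, 0, 1) => x; rewrite lamE /=; ring.
- by exists (1, -1, -1) => x; rewrite lamE /=; ring.
Qed.

Lemma Pk2_affineM (f g : pt R -> R) (d : R) : affine f -> affine g -> Pk 2 (fun x => f x * g x * d).
Proof.
move=> [[[a0 a1] a2] fE] [[[b0 b1] b2] gE]; apply/Pk2E.
exists ((a0 * b0 * d, (a0 * b1 + a1 * b0) * d, (a0 * b2 + a2 * b0) * d),
  (a1 * b1 * d, (a1 * b2 + a2 * b1) * d, a2 * b2 * d)) => x.
by rewrite fE gE /=; ring.
Qed.

Lemma Pk2D (f g : pt R -> R) : Pk 2 f -> Pk 2 g -> Pk 2 (fun x => f x + g x).
Proof.
move=> /Pk2E[[[[a0 a1] a2] [[a3 a4] a5]] fE] /Pk2E[[[[b0 b1] b2] [[b3 b4] b5]] gE].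
apply/Pk2E; exists ((a0 + b0, a1 + b1, a2 + b2), (a3 + b3, a4 + b4, a5 + b5)) => x.
by rewrite fE gE /=; ring.
Qed.

Lemma Pk_ext n (f g : pt R -> R) : f =1 g -> Pk n f -> Pk n g.
Proof. by move=> /funext ->. Qed.

Lemma Pk2_sum (F : option 'I_3 -> pt R -> R) : (forall a, Pk 2 (F a)) ->
  Pk 2 (fun x => \sum_a F a x).
Proof.
move=> PF; apply: (Pk_ext (f := fun x => F None x + F (Some 0) x + F (Some 1) x + F (Some 2) x)).
  by move=> x; rewrite sum_opt3.
exact: (Pk2D (Pk2D (Pk2D (PF _) (PF _)) (PF _)) (PF _)).
Qed.

Lemma hat_ccell k x : ccell k x -> hat (Some k) x = 0.
Proof. by move=> [_ /minlamE m]; rewrite /hat m subrr. Qed.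

(** The hat of vertex k vanishes on the opposite closed subtriangle, so only the six nodes of that
    subtriangle contribute. *)
Lemma sint_ccell k val val' x : ccell k x ->
  (forall a b, a != Some k -> b != Some k -> val (mid a b) = val' (mid a b)) ->
  sint val x = sint val' x.
Proof.
move=> kx H; have h0 := hat_ccell kx.
rewrite /sint; congr (_ - _).
  apply: eq_bigr => a _; apply: eq_bigr => b _.
  have [->|ak] := eqVneq a (Some k); first by rewrite h0 mulr0 !mul0r.
  have [->|bk] := eqVneq b (Some k); first by rewrite h0 mulr0 !mul0r.
  by rewrite H.
apply: eq_bigr => a _; have [->|ak] := eqVneq a (Some k); first by rewrite h0 !mul0r.
by rewrite H.
Qed.

Lemma sint_local k val : exists2 p, Pk 2 p & forall x, ccell k x -> sint val x = p x.
Proof.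
pose h a x : R := if a is Some i then lam i x - lam k x else 3 * lam k x.
have ah a : affine (h a).
  have [[[c0 c1] c2] kE] := affine_lam k.
  case: a => [i|] /=.
    have [[[d0 d1] d2] iE] := affine_lam i.
    by exists (d0 - c0, d1 - c1, d2 - c2) => x; rewrite /h /= iE kE /=; ring.
  by exists (3 * c0, 3 * c1, 3 * c2) => x; rewrite /h /= kE /=; ring.
have a1 : affine (fun=> 1) by exists (1, 0, 0) => x /=; ring.
exists (fun x => (\sum_a \sum_b h a x * h b x * (2 * val (mid a b))) +
  \sum_a h a x * 1 * (- val (mid a a))).
  apply: Pk2D; apply: Pk2_sum => a; last exact: Pk2_affineM.
  by apply: Pk2_sum => b; exact: Pk2_affineM.
move=> x [_ /minlamE m]; rewrite /sint -sumrN; congr (_ + _).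
  apply: eq_bigr => a _; apply: eq_bigr => b _.
  by rewrite /hat /h m; ring.
by apply: eq_bigr => a _; rewrite /hat /h m; ring.
Qed.

Lemma cellW k x : cell k x -> ccell k x.
Proof.
move=> [k0 H]; split=> [|l]; first exact: ltW.
by have [->//|lk] := eqVneq l k; exact/ltW/H.
Qed.

Lemma lam_continuous i : continuous (lam i).
Proof.
have [[[a b] c] lE] := affine_lam i; rewrite (funext lE) => x /=.
apply: cvgD; last by apply: cvgM; [exact: cvg_cst|exact: cvg_snd].
by apply: cvgD; [exact: cvg_cst|apply: cvgM; [exact: cvg_cst|exact: cvg_fst]].
Qed.

Lemma loclip_lam i z : loclip (lam i) z.
Proof.
have [[[a b] c] lE] := affine_lam i; rewrite (funext lE) /=.
apply: loclipD; last by apply: loclipM; [exact: loclip_cst|exact: loclip_snd].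
by apply: loclipD; [exact: loclip_cst|apply: loclipM; [exact: loclip_cst|exact: loclip_fst]].
Qed.

Lemma loclip_sint val z : loclip (sint val) z.
Proof.
have lm : loclip minlam z by apply: loclip_min; [|apply: loclip_min]; exact: loclip_lam.
have lh a : loclip (hat a) z.
  case: a => [i|] /=; first by apply: loclipB => //; exact: loclip_lam.
  by apply: loclipM => //; exact: loclip_cst.
apply: loclipB; apply: loclip_sum => a _.
  apply: loclip_sum => b _; apply: loclipM; last exact: loclip_cst.
  by apply: loclipM => //; apply: loclipM => //; exact: loclip_cst.
by apply: loclipM => //; exact: loclip_cst.
Qed.

Lemma near_lam_gt0 i x : 0 < lam i x -> \forall y \near x, 0 < lam i y.
Proof.
move=> i0; apply: (@lam_continuous i x [set a | 0 < a]).
by apply: open_nbhs_nbhs; split => //; exact: open_gt.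
Qed.

Lemma near_lam_lt i j x : lam i x < lam j x -> \forall y \near x, lam i y < lam j y.
Proof.
move=> ij.
have c : continuous (fun y => lam j y - lam i y).
  by move=> y; apply: cvgB; exact: lam_continuous.
have : \forall y \near x, 0 < lam j y - lam i y.
  apply: (c x [set a | 0 < a]); apply: open_nbhs_nbhs; split => /=; first exact: open_gt.
  by rewrite subr_gt0.
by apply: filterS => y; rewrite subr_gt0.
Qed.

Lemma near_cell k x : cell k x -> \forall y \near x, cell k y.
Proof.
move=> [k0 kl].
have nl l : \forall y \near x, l != k -> lam k y < lam l y.
  have [->|lk] := eqVneq l k; first by near=> y.
  by apply: filterS (near_lam_lt (kl l lk)) => y + _.
near=> y; split; first by near: y; exact: near_lam_gt0.
by apply: ord3P; near: y; exact: nl.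
Unshelve. all: by end_near. Qed.

Lemma node_ccell k a b : a != Some k -> b != Some k -> ccell k (mid a b).
Proof.
move=> ak bk; split=> [|l]; last first.
  by rewrite !lam_mid ler_wpM2r ?invr_ge0// lerD// lam_vert_le.
have v c : 0 <= lam k (vert c).
  by case: c => [i|] /=; rewrite ?lam_bary ?lam_vertex ?invr_ge0// ler0n.
by rewrite lam_mid divr_ge0// addr_ge0.
Qed.

Lemma ref_nodesE x : ref_nodes x <-> exists a b, x = mid a b.
Proof.
have vP y : ct_vertices y <-> exists a, y = vert a.
  split=> [[[i _ <-]|->]|[[i|] ->]].
  - by exists (Some i).
  - by exists None.
  - by left; exists i.
  - by right.
split=> [[/vP[a ->]|[u [w [/vP[a ->] /vP[b ->] _ ->]]]]|[a [b ->]]].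
- by exists a, a; rewrite mid_id.
- by exists a, b.
- have [E|ab] := pselect (vert a = vert b).
    by left; apply/vP; exists a; rewrite /mid -E -/(mid a a) mid_id.
  by right; exists (vert a), (vert b); split => //; apply/vP; [exists a|exists b].
Qed.

Lemma ref_triangleE x : ref_triangle x <-> forall i, 0 <= lam i x.
Proof.
split=> [[p [q [r [p0 q0 r0 pqr ->]]]]|H].
  rewrite /ref_vertex !(tnth_nth 0)/=; elim/ord3P; rewrite !lamE /= /GRing.scale/=; lra.
exists (lam 0 x), (lam 1 x), (lam 2 x); split; rewrite ?lam_sum//.
rewrite /ref_vertex !(tnth_nth 0)/= [LHS]surjective_pairing; congr (_, _);
  by rewrite !lamE /= /GRing.scale/=; ring.
Qed.

Lemma ref_nodes_triangle x : ref_nodes x -> ref_triangle x.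
Proof.
move=> /ref_nodesE[b [c ->]]; apply/ref_triangleE => i.
rewrite lam_mid divr_ge0// addr_ge0//.
  by case: b => [l|] /=; rewrite ?lam_bary ?lam_vertex ?invr_ge0 ?ler0n.
by case: c => [l|] /=; rewrite ?lam_bary ?lam_vertex ?invr_ge0 ?ler0n.
Qed.

Lemma ref_triangle_ccell x : ref_triangle x -> exists k, ccell k x.
Proof.
move=> /ref_triangleE H; have [k kx] := minlam_ex x.
by exists k; split.
Qed.

Lemma ccell_ref k x : ccell k x -> ref_triangle x.
Proof. by move=> [k0 H]; apply/ref_triangleE => i; exact: le_trans (H i). Qed.

End Interpolation.

(** * Members of [Vhat] as interpolants *)

Section VhatRepresentation.
Context {R : realType}.
Implicit Types (x z : pt R) (u : pt R -> R).

Lemma lam_comb l (a b c : pt R) (s t r : R) : s + t + r = 1 ->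
  lam l (s *: a + t *: b + r *: c) = s * lam l a + t * lam l b + r * lam l c.
Proof.
move=> /(canRL (addKr _)) ->.
by elim/ord3P: l; rewrite !lamE /= /GRing.scale/=; ring.
Qed.

Lemma lam_inj x z : (forall l, lam l x = lam l z) -> x = z.
Proof.
move=> H; have := H 0; have := H 1; rewrite !lamE => h2 h1.
by rewrite [x]surjective_pairing h1 h2 -surjective_pairing.
Qed.

Lemma triangle_ccell (i j k : 'I_3) : i != j -> i != k -> j != k ->
  (forall l, [|| l == i, l == j | l == k]) ->
  (forall x, lam i x + lam j x + lam k x = 1) ->
  triangle (ref_vertex i) (ref_vertex j) barycenter = ccell k :> set (pt R).
Proof.
move=> ij ik jk ex sum1; apply/seteqP; split=> x.
  move=> [s [t [r [s0 t0 r0 str ->]]]].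
  have lE l : lam l (s *: ref_vertex i + t *: ref_vertex j + r *: barycenter) =
      s * (l == i)%:R + t * (l == j)%:R + r / 3.
    by rewrite lam_comb// !lam_vertex lam_bary.
  split=> [|l]; rewrite !lE (eq_sym k) (negbTE ik) (eq_sym k) (negbTE jk) !mulr0 !add0r.
    by rewrite divr_ge0.
  by rewrite lerDr addr_ge0// mulr_ge0// ler0n.
(* The weights are the values at x of the hats of the three vertices of the subtriangle. *)
move=> [k0 kl]; exists (lam i x - lam k x), (lam j x - lam k x), (3 * lam k x).
have S : lam i x - lam k x + (lam j x - lam k x) + 3 * lam k x = 1.
  by rewrite -[RHS](sum1 x); ring.
split => //; rewrite ?subr_ge0 ?kl// ?mulr_ge0//.
apply: lam_inj => l; rewrite lam_comb// !lam_vertex lam_bary.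
move: (ex l) => /or3P[] /eqP ->; rewrite ?eqxx.
- by rewrite (negbTE ij) /=; field.
- by rewrite (eq_sym j) (negbTE ij) /=; field.
- by rewrite (eq_sym k) (negbTE ik) (eq_sym k) (negbTE jk) /=; field.
Qed.

Lemma ct_splitE (K : set (pt R)) : ct_split K <-> exists k, K = ccell k.
Proof.
have t01 : triangle (ref_vertex 0) (ref_vertex 1) barycenter = ccell 2 :> set (pt R).
  by apply: triangle_ccell => // [|x]; [exact: ord3P|rewrite -[RHS](lam_sum x)].
have t02 : triangle (ref_vertex 0) (ref_vertex 2) barycenter = ccell 1 :> set (pt R).
  by apply: triangle_ccell => // [|x]; [exact: ord3P|rewrite -[RHS](lam_sum x); ring].
have t12 : triangle (ref_vertex 1) (ref_vertex 2) barycenter = ccell 0 :> set (pt R).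
  by apply: triangle_ccell => // [|x]; [exact: ord3P|rewrite -[RHS](lam_sum x); ring].
split=> [[i [j [ij ->]]]|[k ->]].
  move: i j ij; apply: ord3P; apply: ord3P => //= _.
  - by exists 2.
  - by exists 1.
  - by exists 0.
move: k; apply: ord3P; [exists 1, 2|exists 0, 2|exists 0, 1]; by split.
Qed.

Lemma cell_interior k x : cell k x -> (ccell k : set (pt R))° x.
Proof. by move=> /near_cell; apply: filterS => y; exact: cellW. Qed.

Lemma compact_ref_triangle : compact (ref_triangle : set (pt R)).
Proof.
apply: (@subclosed_compact _ _ (box (0, 0) 1)); last 2 first.
- exact: compact_box.
- move=> x /ref_triangleE H; have := H 0; have := H 1; have := H 2; rewrite !lamE => *.
  by split => /=; rewrite in_itv/=; apply/andP; split; lra.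
have -> : ref_triangle = \bigcap_i [set x : pt R | 0 <= lam i x].
  by apply/seteqP; split => x => [/ref_triangleE H i _|H]; [exact: H|apply/ref_triangleE => i; exact: H].
apply: closed_bigI => i _; apply: (@closed_comp _ _ (lam i) [set a | 0 <= a]).
  by move=> x _; exact: lam_continuous.
exact: closed_ge.
Qed.

Section Edges.
Variables (u : pt R -> R) (P : 'I_3 -> pt R -> R).
Hypotheses (Hu : H1 ref_triangle u) (sP : forall k, smooth (P k))
  (uP : forall k x, cell k x -> u x = P k x).

(** The line x.1 = s + k x.2 carries the common edge of subtriangles i and j, with i on its left and
    j on its right. Near a point of the open edge every point off the line is in one of these two
    cells, which is the setting of [jump_zero]. *)
Lemma edge_interior (i j l : 'I_3) (s k : R) z :
  (forall m, [|| m == i, m == j | m == l]) ->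
  (forall x, x.1 < s + k * x.2 -> lam i x < lam j x) ->
  (forall x, s + k * x.2 < x.1 -> lam j x < lam i x) ->
  lam i z = lam j z -> 0 < lam i z -> lam i z < lam l z -> P i z = P j z.
Proof.
move=> ex sl sr zij zi zl.
have pos m : 0 < lam m z.
  by move: (ex m) => /or3P[] /eqP ->; rewrite -?zij//; exact: lt_trans zl.
have zl' : lam j z < lam l z by rewrite -zij.
have : \forall y \near z, (forall m, 0 < lam m y) /\ lam i y < lam l y /\ lam j y < lam l y.
  near=> y; split; first by apply: ord3P; near: y; exact: near_lam_gt0.
  by split; near: y; exact: near_lam_lt.
move=> /nbhs_ballP[r /= r0 Hr].
have [L2u /(_ 0)[g L2g wg]] := Hu.
apply: (jump_zero (U := ref_triangle°) (u := u) (g := g) (s := s) (k := k) (r := r)) => //.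
- exact: open_interior.
- exact/area_compact_interior/compact_ref_triangle.
- rewrite -open_subsetE; last exact: ball_open.
  by move=> x /Hr[H _]; apply/ref_triangleE => m; exact: ltW.
- move=> x /Hr[H [h1 h2]] /sl h; apply: uP; split => // m mi.
  by move: (ex m); rewrite (negbTE mi)/= => /orP[] /eqP ->.
- move=> x /Hr[H [h1 h2]] /sr h; apply: uP; split => // m mj.
  by move: (ex m); rewrite (negbTE mj)/= => /orP[] /eqP ->.
- by case: (ltgtP z.1 (s + k * z.2)) => // [/sl|/sr]; rewrite zij ltxx.
Unshelve. all: by end_near. Qed.

Lemma smooth_line_cvg f (z v : pt R) : smooth f ->
  f (z + harm 0 n *: v) @[n --> \oo] --> f z.
Proof.
move=> sf; have [f' _ df] := smooth_derive v sf.
have d0 : is_derive (0 : R) 1 (fun t : R => f (z + t *: v)) (f' z).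
  by apply/is_derive_line0.
have c0 : {for (0 : R), continuous (fun t : R => f (z + t *: v))}.
  by apply: differentiable_continuous; apply/derivable1_diffP; case: d0.
have E : f z = f (z + (0 : R) *: v) by rewrite scale0r addr0.
by rewrite E; apply: (cvg_comp (harm 0) (fun t : R => f (z + t *: v)) (@cvg_harm R 0)).
Qed.

(** The ends of the edge, vertex l and the barycenter, are limits of points of the open edge: z is
    approached along the segment towards the midpoint m of the edge. *)
Lemma edge_closed (i j l : 'I_3) (s k : R) z : i != l -> j != l ->
  (forall m, [|| m == i, m == j | m == l]) ->
  (forall x, x.1 < s + k * x.2 -> lam i x < lam j x) ->
  (forall x, s + k * x.2 < x.1 -> lam j x < lam i x) ->
  ccell i z -> ccell j z -> P i z = P j z.
Proof.
move=> il jl ex sl sr [i0 zi] [j0 zj].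
have zij : lam i z = lam j z by apply/eqP; rewrite eq_le zi zj.
pose m : pt R := mid (Some l) None.
have lm a : a != l -> lam a m = 3^-1 / 2.
  by move=> al; rewrite lam_mid /= lam_vertex lam_bary (negbTE al) add0r.
have lml : lam l m = (1 + 3^-1) / 2 by rewrite lam_mid /= lam_vertex lam_bary eqxx.
have HP n : P i (z + harm 0 n *: (m - z)) = P j (z + harm 0 n *: (m - z)).
  have h0 := @harm_gt0 R 0 n; have := @harm_le R 0 n; rewrite invr1.
  move: (harm 0 n) h0 => e e0 e1.
  have -> : z + e *: (m - z) = (1 - e) *: z + e *: m.
    by rewrite scalerBr scalerBl scale1r addrA addrAC.
  apply: (edge_interior ex sl sr); rewrite !lam_affine (lm i il) ?(lm j jl) ?lml.
  - by rewrite zij.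
  - by rewrite ltr_wpDl// ?mulr_ge0// ?subr_ge0// mulr_gt0//; lra.
  - apply: ler_ltD; last by rewrite ltr_pM2l//; lra.
    by apply: ler_wpM2l; rewrite ?subr_ge0.
have ci := smooth_line_cvg (z := z) (m - z) (sP i).
have cj := smooth_line_cvg (z := z) (m - z) (sP j).
rewrite -(funext HP) in cj.
exact: (cvg_unique _ ci cj).
Qed.

Lemma edge_all i j z : ccell i z -> ccell j z -> P i z = P j z.
Proof.
(* The constants s and k come from solving [lam i] = [lam j] for x.1; the three lines are the
   medians. *)
have e12 : forall z, ccell 1 z -> ccell 2 z -> P 1 z = P 2 z.
  move=> w; apply: (@edge_closed 1 2 0 1 (-2)) => //; first exact: ord3P.
    by move=> x; rewrite !lamE; lra.
  by move=> x; rewrite !lamE; lra.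
have e02 : forall z, ccell 0 z -> ccell 2 z -> P 0 z = P 2 z.
  move=> w; apply: (@edge_closed 0 2 1 (2^-1) (- 2^-1)) => //; first exact: ord3P.
    by move=> x; rewrite !lamE; lra.
  by move=> x; rewrite !lamE; lra.
have e01 : forall z, ccell 0 z -> ccell 1 z -> P 0 z = P 1 z.
  move=> w; apply: (@edge_closed 0 1 2 0 1) => //; first exact: ord3P.
    by move=> x; rewrite !lamE; lra.
  by move=> x; rewrite !lamE; lra.
by elim/ord3P: i; elim/ord3P: j => //; auto; move=> h1 h2; apply/esym; auto.
Qed.

End Edges.

Lemma scalar_representation u :
  H1 ref_triangle u ->
  (forall K, ct_split K -> exists2 p, Pk 2 p & forall x, K° x -> u x = p x) ->
  exists val, forall k x, cell k x -> u x = sint val x.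
Proof.
move=> Hu uK.
have /choice[P HP] k : exists p, Pk 2 p /\ forall x, cell k x -> u x = p x.
  have [|p p2 up] := uK (ccell k); first by apply/ct_splitE; exists k.
  by exists p; split => // x /cell_interior; exact: up.
have PE := edge_all Hu (fun k => Pk_smooth (HP k).1) (fun k => (HP k).2).
have /choice[am Ham] x : exists k, forall l, lam k x <= lam l x := minlam_ex x.
(* The nodal value is read off the polynomial of any closed subtriangle containing the node;
   agreement on common edges makes the choice immaterial. *)
exists (fun x => P (am x) x) => k x kx.
rewrite (HP k).2// -(sint_Pk2 x (HP k).1).
apply: (sint_ccell (cellW kx)) => a b ak bk.
have kn : ccell k (mid a b : pt R) := node_ccell ak bk; apply: PE => //.
have /ref_triangleE pos := ccell_ref kn.

by split=> [|l]; [exact: pos|exact: Ham].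
Qed.

Definition ivec (val : pt R -> 'cV[R]_2) x : 'cV[R]_2 :=
  \col_i sint (fun a => val a i 0) x.

Lemma Vhat_representation v : Vhat v ->
  exists val, forall k x, cell k x -> v x = ivec val x.
Proof.
move=> [Hv vK].
have /choice[f Hf] i : exists val, forall k x, cell k x -> v x i 0 = sint val x.
  by apply: scalar_representation => // K cK; exact: vK.
exists (fun a => \col_i f i a) => k x kx; apply/colP => i.
rewrite mxE (Hf i k x kx); apply: sint_ext => a b; by rewrite mxE.
Qed.

End VhatRepresentation.

(** * Quadratic maps and the image of the skeleton *)

Section QuadraticMaps.
Context {R : realType}.
Implicit Types (x z : pt R) (f : pt R -> R).

(** The second-order Taylor formula without remainder; the quadratic form A is the same at every
    base point. *)
Lemma Pk2_expansion f : Pk 2 f -> exists A : pt R -> R, forall x (d : pt R) (t : R),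
  f (x + t *: d) = f x + t * (d.1 * 'D_(edir 0) f x + d.2 * 'D_(edir 1) f x) + t ^+ 2 * A d.
Proof.
move=> Pf; have := Pf => /Pk2E[[[[c0 c1] c2] [[c3 c4] c5]] /= fE].
pose A (d : pt R) := c3 * d.1 ^+ 2 + c4 * (d.1 * d.2) + c5 * d.2 ^+ 2.
pose B (x d : pt R) := d.1 * (c1 + 2 * c3 * x.1 + c4 * x.2) + d.2 * (c2 + c4 * x.1 + 2 * c5 * x.2).
have E x d t : f (x + t *: d) = f x + t * B x d + t ^+ 2 * A d.
  by rewrite !fE /A /B /= /GRing.scale/=; ring.
have D x d : 'D_d f x = B x d.
  have h : is_derive (0 : R) 1 (fun t : R => f (x + t *: d)) (B x d).
    rewrite (_ : (fun t : R => _) = fun t => f x + t * B x d + t ^+ 2 * A d); last first.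
      by apply/funext => t; exact: E.
    by apply: is_derive_eq; rewrite /GRing.scale/=; ring.
  by have /is_derive_line0[] := h.
exists A => x d t; rewrite E !D; congr (_ + _ * _ + _).
by rewrite /B /edir /=; ring.
Qed.

Lemma Pk2_segment_lipschitz f (a d : pt R) : Pk 2 f -> exists2 L : R, 0 < L &
  forall s t, 0 <= s <= 1 -> 0 <= t <= 1 ->
    `|f (a + s *: d) - f (a + t *: d)| <= L * `|s - t|.
Proof.
move=> /Pk2_expansion[A E].
pose B := d.1 * 'D_(edir 0) f a + d.2 * 'D_(edir 1) f a.
exists (`|B| + 2 * `|A d| + 1); first by rewrite ltr_pwDr// addr_ge0// mulr_ge0.
move=> s t /andP[s0 s1] /andP[t0 t1]; rewrite !E -/B.
have -> : f a + s * B + s ^+ 2 * A d - (f a + t * B + t ^+ 2 * A d) =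
  (B + (s + t) * A d) * (s - t) by ring.
rewrite normrM ler_wpM2r// (le_trans (ler_normD _ _))// -addrA lerD2l.
rewrite normrM ger0_norm ?addr_ge0//.
by have := normr_ge0 (A d); nra.
Qed.

Lemma negligible_quadratic_segment (F : pt R -> pt R) (a d : pt R) : quadratic_map F ->
  area.-negligible ((fun t : R => F (a + t *: d)) @` `[0, 1] : set (mplane R)).
Proof.
move=> qF.
have [L0 L00 H0] := Pk2_segment_lipschitz a d (qF 0).
have [L1 L10 H1] := Pk2_segment_lipschitz a d (qF 1).
apply: (@negligible_curve _ _ (L0 + L1)); first exact: addr_gt0.
move=> s t s01 t01; rewrite prod_normE ge_max mulrDl; apply/andP; split.
  by apply: le_trans (H0 s t s01 t01) _; rewrite lerDl mulr_ge0// ltW.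
by apply: le_trans (H1 s t s01 t01) _; rewrite lerDr mulr_ge0// ltW.
Qed.

Lemma negligible_skeleton (F : pt R -> pt R) : quadratic_map F ->
  area.-negligible (F @` [set x | ref_triangle x /\ forall k, ~ cell k x] : set (mplane R)).
Proof.
move=> qF.
have n := negligible_quadratic_segment _ _ qF.
(* The three sides and, carrying the inner edges, three segments along the medians, each given by a
   starting point and a direction. *)
have := negligibleU (negligibleU (negligibleU (n (0, 0) (0, 1)) (n (0, 0) (1, 0)))
                                 (negligibleU (n (0, 1) (1, -1)) (n (0, 0) (1, 1))))
                    (negligibleU (n (0, 1) (1, -2)) (n (1, 0) (-2, 1))).
apply: negligibleS => _ [x [Tx nc] <-].
have /ref_triangleE pos := Tx.
have [k [k0 kx]] := ref_triangle_ccell Tx.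
have x1 : 0 <= x.1 <= 1.
  by have := pos 0; have := pos 1; have := pos 2; rewrite !lamE => *; apply/andP; split; lra.
have x2 : 0 <= x.2 <= 1.
  by have := pos 0; have := pos 1; have := pos 2; rewrite !lamE => *; apply/andP; split; lra.
have xE (y : pt R) : y.1 = x.1 -> y.2 = x.2 -> F y = F x.
  by case: y => y1 y2 /= -> ->; rewrite -surjective_pairing.
pose seg (a d : pt R) : set (pt R) := (fun t : R => F (a + t *: d)) @` `[0, 1].
have z0 : lam 0 x = 0 -> seg (0, 0) (0, 1) (F x).
  rewrite !lamE => e; exists x.2; first by rewrite /= in_itv.
  by apply: xE; rewrite /= /GRing.scale/=; lra.
have z1 : lam 1 x = 0 -> seg (0, 0) (1, 0) (F x).
  rewrite !lamE => e; exists x.1; first by rewrite /= in_itv.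
  by apply: xE; rewrite /= /GRing.scale/=; lra.
have z2 : lam 2 x = 0 -> seg (0, 1) (1, -1) (F x).
  rewrite !lamE => e; exists x.1; first by rewrite /= in_itv.
  by apply: xE; rewrite /= /GRing.scale/=; lra.
have z01 : lam 0 x = lam 1 x -> seg (0, 0) (1, 1) (F x).
  rewrite !lamE => e; exists x.1; first by rewrite /= in_itv.
  by apply: xE; rewrite /= /GRing.scale/=; lra.
have z02 : lam 0 x = lam 2 x -> seg (0, 1) (1, -2) (F x).
  rewrite !lamE => e; exists x.1; first by rewrite /= in_itv.
  by apply: xE; rewrite /= /GRing.scale/=; lra.
have z12 : lam 1 x = lam 2 x -> seg (1, 0) (-2, 1) (F x).
  rewrite !lamE => e; exists x.2; first by rewrite /= in_itv.
  by apply: xE; rewrite /= /GRing.scale/=; lra.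
have [k00|kn0] := eqVneq (lam k x) 0.
  by move: k k0 kx k00; apply: ord3P => _ _ e;
    [left; left; left; apply: z0|left; left; right; apply: z1|left; right; left; apply: z2].
have [l [lk le]] : exists l, l != k /\ lam l x = lam k x.
  apply: contrapT => H; apply: (nc k); split; first by rewrite lt_neqAle eq_sym kn0.
  move=> l lk; rewrite lt_neqAle kx andbT; apply/eqP => e; apply: H.
  by exists l.
move: k l lk le {k0 kx kn0}; apply: ord3P; apply: ord3P => // _ e.
- by left; right; right; exact: z01.
- by right; left; exact: z02.
- by left; right; right; exact: z01.
- by right; right; exact: z12.
- by right; left; exact: z02.
- by right; right; exact: z12.
Qed.

(** Induction on the construction of f replaces the chain rule in two variables by sums, products
    and one-variable composition. *)
Lemma smooth_comp_derivable f (G : pt R -> pt R) (y v : pt R) : smooth f ->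
  derivable (fun x => (G x).1) y v -> derivable (fun x => (G x).2) y v ->
  derivable (fun x => f (G x)) y v.
Proof.
move=> sf d1 d2; elim: sf => [c|||f1 f2 _ h1 _ h2|f1 f2 _ h1 _ h2|n f1 _ h1].
- exact: derivable_cst.
- exact: d1.
- exact: d2.
- exact: derivableD.
- exact: derivableM.
- have /derivableP h := h1.
  by have [] := is_derive_comp_line h (is_derive_flat n (f1 (G y))).
Qed.

End QuadraticMaps.

(** * Openness of a nondegenerate quadratic map *)

Section OpenMapping.
Context {R : realType}.
Implicit Types (x y : pt R).

Lemma det_jac (F : pt R -> pt R) x : \det (jac F x) =
  'D_(edir 0) (fun y => (F y).1) x * 'D_(edir 1) (fun y => (F y).2) x -
  'D_(edir 1) (fun y => (F y).1) x * 'D_(edir 0) (fun y => (F y).2) x.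
Proof.
rewrite (expand_det_row _ 0) !big_ord_recl big_ord0 /cofactor !det_mx11 !mxE /=.
by rewrite /bump/= expr0 expr1 !mul1r mulN1r mulrN addr0.
Qed.

(* F x* = y at a point x* of a small box minimising |F x - y|^2: otherwise the
   Newton direction would decrease it. *)
Lemma quadratic_open (F G : pt R -> pt R) x1 (rho : R) : quadratic_map F ->
  0 < rho -> (forall x, ball x1 rho x -> G (F x) = x) ->
  {for F x1, continuous G} ->
  (forall x, ball x1 rho x -> \det (jac F x) != 0) ->
  exists2 r : R, 0 < r & forall y, ball (F x1) r y -> exists2 x, ball x1 rho x & F x = y.
Proof.
move=> qF rho0 GF cG detF.
have q1 : Pk 2 (fun x => (F x).1) := qF 0.
have q2 : Pk 2 (fun x => (F x).2) := qF 1.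
pose K : set (pt R) := box x1 (rho / 2).
have Kb x : K x -> ball x1 rho x.
  move=> [/= + +]; rewrite !in_itv/= => /andP[? ?] /andP[? ?].
  by split; rewrite /ball/= ltr_distl; apply/andP; split; lra.
have Kx1 : K x1 by split => /=; rewrite in_itv/=; apply/andP; split; lra.
have r20 : 0 < rho / 2 by lra.
have [d d0 dG] : exists2 d : R, 0 < d & forall y, ball (F x1) d y -> ball x1 (rho / 2) (G y).
  have /cvg_ballP/(_ _ r20)/nbhs_ballP[d /= d0 H] := cG.
  exists d => // y /H; rewrite GF//; exact: ballxx.
(* Then N x1 <= 2 (d/4)^2 = d^2/8, so at the minimiser each residual is below d/2 and its image
   stays within d of F x1. Continuity of G then puts the minimiser in the interior of the box, where
   it can be moved in any direction. *)
exists (d / 4); first by lra.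
move=> y [/= y1 y2]; move: y1 y2; rewrite /ball/= => y1 y2.
pose N x : R := ((F x).1 - y.1) ^+ 2 + ((F x).2 - y.2) ^+ 2.
have cN : continuous N.
  have sN f (c : R) : Pk 2 f -> smooth (fun x : pt R => (f x - c) ^+ 2).
    move=> /Pk_smooth sf; apply: smoothX; apply: smoothD => //.
    exact: smooth_cst.
  by apply: smooth_continuous; apply: smoothD; exact: sN.
have [|||xs /set_mem Kxs minN] := @compact_EVT_min _ R N K.
- by exists x1.
- exact: compact_box.
- exact: continuous_subspaceT.
have Nx1 : N x1 <= d ^+ 2 / 8.
  rewrite /N; move: y1 y2; rewrite !ltr_norml => /andP[? ?] /andP[? ?]; nra.
have Nxs : N xs <= d ^+ 2 / 8 by apply: le_trans Nx1; apply: minN; rewrite inE.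
have Fxs : ball (F x1) d (F xs).
  have sq (a b : R) : a ^+ 2 + b ^+ 2 <= d ^+ 2 / 8 -> `|a| < d / 2.
    by move=> h; rewrite ltr_norml; apply/andP; split; nra.
  have a1 := sq _ _ Nxs; have a2 := Nxs; rewrite /N addrC in a2; have {}a2 := sq _ _ a2.
  split; rewrite /ball/=.
    by rewrite (le_lt_trans (ler_distD y.1 _ _))// (distrC y.1); lra.
  by rewrite (le_lt_trans (ler_distD y.2 _ _))// (distrC y.2); lra.
have xsI : ball x1 (rho / 2) xs by have := dG _ Fxs; rewrite GF//; exact: Kb.
exists xs; first exact: Kb.
pose e1 := (F xs).1 - y.1; pose e2 := (F xs).2 - y.2.
suff : e1 = 0 /\ e2 = 0.
  move=> [/eqP + /eqP]; rewrite !subr_eq0 => /eqP h1 /eqP h2.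
  by rewrite [LHS]surjective_pairing h1 h2 -surjective_pairing.
have [A1 E1] := Pk2_expansion q1; have [A2 E2] := Pk2_expansion q2.
have := detF _ (Kb _ Kxs); rewrite det_jac.
set a := 'D_(edir 0) _ xs; set b := 'D_(edir 1) _ xs.
set b' := 'D_(edir 1) (fun y => (F y).1) xs; set c := 'D_(edir 0) (fun y => (F y).2) xs.
move=> det0.
(* Cramer's rule for DF v = -(e1, e2). As the expansion is exact, the residual along v is (1 - t) e
   + t^2 A v. *)
pose v : pt R := (- (b * e1 - b' * e2) / (a * b - b' * c), - (a * e2 - c * e1) / (a * b - b' * c)).
have v1 : v.1 * a + v.2 * b' = - e1 by rewrite /v /=; field.
have v2 : v.1 * c + v.2 * b = - e2 by rewrite /v /=; field.
have NE t : N (xs + t *: v) = ((1 - t) * e1 + t ^+ 2 * A1 v) ^+ 2 + ((1 - t) * e2 + t ^+ 2 * A2 v) ^+ 2.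
  rewrite /N E1 E2 -/a -/b -/b' -/c v1 v2 /e1 /e2; congr (_ ^+ 2 + _ ^+ 2); ring.
have near0 : \forall t \near (0 : R)^'+, K (xs + t *: v).
  have : \forall y \near xs, K y.
    have := open_nbhs_nbhs (conj (ball_open x1 (rho / 2)) xsI).
    apply: filterS => z [+ +]; rewrite /ball/= => h1 h2.
    by split => /=; rewrite in_itv/= -ler_distl distrC ltW.
  move=> /nbhs_ballP[m /= m0 Hm].
  near=> t; apply: Hm; rewrite -ball_normE/= opprD addrA subrr sub0r normrN normrZ.
  have v10 : 0 < `|v| + 1 by rewrite ltr_wpDl.
  apply: (@le_lt_trans _ _ (`|t| * (`|v| + 1))); first by rewrite ler_wpM2l// lerDl.
  rewrite -ltr_pdivlMr// gtr0_norm; last by near: t; exact: nbhs_right_gt.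
  by near: t; apply: nbhs_right_lt; rewrite divr_gt0.
have S0 : e1 ^+ 2 + e2 ^+ 2 <= 0.
  rewrite leNgt; apply/negP => S0.
  pose S := e1 ^+ 2 + e2 ^+ 2; pose T := e1 * A1 v + e2 * A2 v; pose Q := A1 v ^+ 2 + A2 v ^+ 2.
  have Q0 : 0 <= Q by rewrite addr_ge0// sqr_ge0.
  (* N(xs + t v) - S equals t (t S + 2 (1 - t) t T + t^3 Q - 2 S); the first three terms are at most
     2 t M, so any t < S/(2M) with 0 < t < 1 makes the difference negative. *)
  pose M : R := 1 + `|T| + Q + S.
  have {}S0 : 0 < S := S0.
  have M0 : 0 < M.
    have := normr_ge0 T; rewrite /M; move: (`|T|) (S) (Q) S0 Q0 => u1 u2 u3 *; lra.
  have near1 : \forall t \near (0 : R)^'+, t < S / (2 * M).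
    by apply: nbhs_right_lt; rewrite divr_gt0// mulr_gt0.
  have near2 : \forall t \near (0 : R)^'+, t < 1 by exact: nbhs_right_lt.
  have [t t0 [tK [tS t1]]] := near_at_right (filterI near0 (filterI near1 near2)).
  have := minN _ (mem_set tK); rewrite NE.
  have -> : N xs = S by [].
  have -> : ((1 - t) * e1 + t ^+ 2 * A1 v) ^+ 2 + ((1 - t) * e2 + t ^+ 2 * A2 v) ^+ 2 =
    (1 - t) ^+ 2 * S + 2 * (1 - t) * t ^+ 2 * T + t ^+ 4 * Q by rewrite /S /T /Q; ring.
  apply/negP; rewrite -ltNge.
  have tM : t * (2 * M) < S by rewrite -ltr_pdivlMr// mulr_gt0.
  have T1 : T <= `|T| := ler_norm T.
  have h1 : (1 - t) * t * T <= t * `|T|.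
    apply: (@le_trans _ _ ((1 - t) * t * `|T|)); first by rewrite ler_wpM2l// mulr_ge0; lra.
    by rewrite ler_wpM2r// ler_piMl//; lra.
  have h2 : t ^+ 3 * Q <= t * Q.
    by rewrite ler_wpM2r// exprS ler_piMr ?exprn_ile1//; lra.
  have h3 : t * S + 2 * (t * `|T|) + t * Q <= t * (2 * M).
    have tT := mulr_ge0 (ltW t0) (normr_ge0 T); have tQ := mulr_ge0 (ltW t0) Q0.
    have tS0 := mulr_ge0 (ltW t0) (ltW S0).
    have -> : t * (2 * M) = 2 * t + 2 * (t * `|T|) + 2 * (t * Q) + 2 * (t * S).
      by rewrite /M; ring.
    lra.
  have h : t * S + 2 * ((1 - t) * t * T) + t ^+ 3 * Q < 2 * S by lra.
  have := h; rewrite -(ltr_pM2l t0) => {}h.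
  have -> : (1 - t) ^+ 2 * S + 2 * (1 - t) * t ^+ 2 * T + t ^+ 4 * Q =
    S + (t * (t * S + 2 * ((1 - t) * t * T) + t ^+ 3 * Q) - t * (2 * S)) by ring.
  lra.
have s1 := sqr_ge0 e1; have s2 := sqr_ge0 e2.
by split; apply/eqP; rewrite -sqrf_eq0; apply/eqP; lra.
Unshelve. all: by end_near. Qed.

End OpenMapping.

(** * Transport of the interpolants to an element *)

Section Element.
Context {R : realType}.
Variables (F G : pt R -> pt R) (U : set (pt R)).
Let D : set (pt R) := F @` ref_triangle.
Hypotheses (qF : quadratic_map F)
  (detF : forall x, ref_triangle x -> \det (jac F x) != 0)
  (GF : forall x, ref_triangle x -> G (F x) = x)
  (oU : open U) (DU : D `<=` U) (CG : forall i, Ck 1 U (fun x => coor i (G x))).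

(** The Piola image of an interpolant, [val] being the nodal data on the reference triangle and [G]
    the inverse of [F]. As [G] is C^1 on a neighbourhood of the element, the formula is locally
    Lipschitz up to and including the boundary. *)
Definition push (val : pt R -> 'cV[R]_2) (y : pt R) : 'cV[R]_2 :=
  piola F (G y) *m ivec val (G y).

Let smooth_coorF i : smooth (fun x => coor i (F x)) := Pk_smooth (qF i).

Let smooth_jac i j : smooth (fun x => jac F x i j).
Proof.
have [f' sf' df] := smooth_derive (edir j) (smooth_coorF i).
by apply: smooth_ext sf' => x; rewrite mxE; have [_ ->] := df x.
Qed.

Let smooth_det : smooth (fun x => \det (jac F x)).
Proof.
apply: (smooth_ext (f := fun x => jac F x 0 0 * jac F x 1 1 + (-1) * (jac F x 0 1 * jac F x 1 0))).
  by move=> x; rewrite det_jac !mxE mulN1r.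
apply: smoothD; first exact: smoothM.
by apply: smoothM; [exact: smooth_cst|exact: smoothM].
Qed.

Let loclipG y : U y -> loclip (fst \o G) y /\ loclip (snd \o G) y.
Proof.
by move=> Uy; split; [exact: (Ck1_loclip oU (CG 0))|exact: (Ck1_loclip oU (CG 1))].
Qed.

Lemma continuousG y : U y -> {for y, continuous G}.
Proof.
move=> /loclipG[g1 g2]; apply/cvg_ballP => e e0.
have /cvg_ballP/(_ _ e0) := loclip_continuous g1.
have /cvg_ballP/(_ _ e0) := loclip_continuous g2.
by apply: filterS2 => x ? ?; split.
Qed.

Lemma pushE val y i : push val y i 0 =
  \sum_j (\det (jac F (G y)))^-1 * jac F (G y) i j * sint (fun a => val a j 0) (G y).
Proof. by rewrite mxE; apply: eq_bigr => j _; rewrite !mxE. Qed.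

Let DG y : D y -> ref_triangle (G y).
Proof. by move=> [x Tx <-]; rewrite GF. Qed.

Let FG y : D y -> F (G y) = y.
Proof. by move=> [x Tx <-]; rewrite GF. Qed.

Lemma loclip_push val i y : D y -> loclip (fun z => push val z i 0) y.
Proof.
move=> Dy; have [g1 g2] := loclipG (DU Dy).
apply: (loclip_ext (fun z => esym (pushE val z i))).
have lc f : loclip f (G y) -> loclip (f \o G) y by exact: loclip_comp.
apply: loclip_sum => j _; apply: loclipM; last exact: lc (loclip_sint _ _).
apply: loclipM; last exact: lc (smooth_loclip _ (smooth_jac i j)).
by apply: loclipV; [exact: detF (DG Dy)|exact: lc (smooth_loclip _ smooth_det)].
Qed.

(** By continuity G maps a neighbourhood of y into the open subtriangle, where the interpolant is a
    single polynomial. *)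
Lemma derivable_push val i y k m : D y -> cell k (G y) ->
  derivable (fun z => push val z i 0) y (edir m).
Proof.
move=> Dy kGy; have Uy := DU Dy.
have g1 : derivable (fun z => (G z).1) y (edir m) by have [h _] := CG 0 m; exact: h.
have g2 : derivable (fun z => (G z).2) y (edir m) by have [h _] := CG 1 m; exact: h.
have sc f : smooth f -> derivable (fun z => f (G z)) y (edir m).
  by move=> sf; exact: smooth_comp_derivable.
have ncell : \forall z \near y, cell k (G z).
  exact: (continuousG Uy (near_cell kGy)).
pose h j (z : pt R) : R :=
  (\det (jac F (G z)))^-1 * jac F (G z) i j * sint (fun a => val a j 0) (G z).
rewrite (_ : (fun z => _) = \sum_j h j); last first.
  by apply/funext => z; rewrite pushE fct_sumE.
apply: derivable_sum => j.
apply: derivableM.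
  apply: derivableM; last exact: (sc _ (smooth_jac i j)).
  by apply: derivableV; [exact: detF (DG Dy)|exact: (sc _ smooth_det)].
have [p p2 sp] := sint_local k (fun a => val a j 0).
apply: (near_eq_derivable (f := fun z => p (G z))); last exact: (sc _ (Pk_smooth p2)).
by apply: filterS ncell => z /cellW /sp ->.
Qed.

Lemma compact_element : compact D.
Proof.
apply: continuous_compact; last exact: compact_ref_triangle.
apply: continuous_subspaceT => x; apply/cvg_ballP => e e0.
have /cvg_ballP/(_ _ e0) := @smooth_continuous _ _ (smooth_coorF 0) x.
have /cvg_ballP/(_ _ e0) := @smooth_continuous _ _ (smooth_coorF 1) x.
by apply: filterS2 => z ? ?; split.
Qed.

Lemma ae_cell : {ae area, forall y : mplane R, D y -> exists k, cell k (G y)}.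
Proof.
apply: negligibleS (negligible_skeleton qF) => y /= /not_implyP[[x Tx <-] nk].
by exists x => //; split => // k kx; apply: nk; exists k; rewrite GF.
Qed.

Lemma H1_push val : H1vec D (push val).
Proof.
move=> i; apply: loclip_H1; first exact: compact_element.
  by move=> y Dy; exact: loclip_push.
apply: filterS ae_cell => y H Dy m; have Dy' := interior_subset Dy.
by have [k] := H Dy'; exact: derivable_push.
Qed.

Lemma continuous_push val : {within D, continuous (push val)}.
Proof.
apply: continuous_in_subspaceT => y /set_mem Dy.
have E : push val = fun z => push val z 0 0 *: delta_mx 0 0 + push val z 1 0 *: delta_mx 1 0.
  apply/funext => z; rewrite [LHS]matrix_sum_delta !big_ord_recl !big_ord0 !addr0 /=.
  by congr (_ + push val z _ _ *: delta_mx _ _); exact/val_inj.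
rewrite E; apply: cvgD; apply: cvgZr_tmp; exact: loclip_continuous (loclip_push _ _ Dy).
Qed.

Lemma push_node val x : ref_nodes x -> push val (F x) = piola F x *m val x.
Proof.
move=> nx; rewrite /push GF; last exact: ref_nodes_triangle.
have /ref_nodesE[a [b ->]] := nx.
congr (_ *m _); apply/colP => i.
by rewrite mxE sint_node.
Qed.

Lemma push_ext val val' : (forall x, ref_nodes x -> val x = val' x) ->
  push val =1 push val'.
Proof.
move=> H y; congr (_ *m _); apply/colP => i; rewrite !mxE.
by apply: sint_ext => a b; rewrite H//; apply/ref_nodesE; exists a, b.
Qed.

(** Moving G y slightly towards the barycenter gives an interior point of the reference triangle, at
    which F is open. *)
Lemma element_interior_dense y (e : R) : D y -> 0 < e ->
  exists z r, [/\ 0 < r, ball z r `<=` D & ball z r `<=` ball y e].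
Proof.
move=> Dy e0; have TG := DG Dy.
have cF : {for G y, continuous F}.
  apply/cvg_ballP => d d0.
  have /cvg_ballP/(_ _ d0) := @smooth_continuous _ _ (smooth_coorF 0) (G y).
  have /cvg_ballP/(_ _ d0) := @smooth_continuous _ _ (smooth_coorF 1) (G y).
  by apply: filterS2 => z ? ?; split.
have /cvg_ballP/(_ _ e0)/nbhs_ballP[d /= d0 Hd] := cF.
pose v : pt R := barycenter - G y.
(* Chosen so that 0 < t < 1 and |t v| < d; adding 1 to |v| covers the case v = 0. *)
pose t : R := Num.min 1 (d / (`|v| + 1)) / 2.
have v0 : 0 < `|v| + 1 by rewrite ltr_wpDl.
have t0 : 0 < t by rewrite divr_gt0// lt_min ltr01 divr_gt0.
have t1 : t < 1.
  have : Num.min 1 (d / (`|v| + 1)) <= 1 by rewrite ge_min lexx.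
  by rewrite /t; lra.
have td : t * (`|v| + 1) < d.
  have : Num.min 1 (d / (`|v| + 1)) <= d / (`|v| + 1) by rewrite ge_min lexx orbT.
  rewrite ler_pdivlMr// => h.
  rewrite /t mulrAC ltr_pdivrMr//; apply: le_lt_trans h _; lra.
pose x1 := (1 - t) *: G y + t *: barycenter.
have x1d : ball (G y) d x1.
  rewrite -ball_normE/=; apply: le_lt_trans td.
  have -> : G y - x1 = - (t *: v).
    rewrite /x1 /v; move: (G y) (barycenter : pt R) => [p q] [p' q'].
    by congr (_, _); rewrite /= /GRing.scale/=; ring.
  by rewrite normrN normrZ gtr0_norm// ler_wpM2l ?lerDl// ltW.
have x1pos i : 0 < lam i x1.
  rewrite lam_affine lam_bary ltr_wpDl//; last by rewrite mulr_gt0// invr_gt0.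
  by rewrite mulr_ge0//; [lra|have /ref_triangleE := TG; exact].
have : \forall x \near x1, forall i, 0 < lam i x.
  by near=> x; apply: ord3P; near: x; exact: near_lam_gt0.
move=> /nbhs_ballP[rho /= rho0 Hrho].
have T x : ball x1 rho x -> ref_triangle x.
  by move=> /Hrho H; apply/ref_triangleE => i; exact: ltW.
have Dx1 : D (F x1) by exists x1 => //; apply: T; exact: ballxx.
have [r r0 Hr] := quadratic_open qF rho0 (fun x Hx => GF (T x Hx))
  (continuousG (DU Dx1)) (fun x Hx => detF (T x Hx)).
have /nbhs_ballP[s /= s0 Hs] : \forall z \near F x1, ball y e z.
  have : ball y e (F x1) by have := Hd _ x1d; rewrite FG.
  by move=> h; apply: open_nbhs_nbhs; split => //; exact: ball_open.
exists (F x1), (Num.min r s); split.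
- by rewrite lt_min r0.
- move=> z zb; have [|x /T Tx <-] := Hr z; last by exists x.
  by apply: le_ball zb; rewrite ge_min lexx.
- by move=> z zb; apply: Hs; apply: le_ball zb; rewrite ge_min lexx orbT.
Unshelve. all: by end_near. Qed.

(* Every point of F @` ref_triangle is a limit of its interior points, near
   which w1 = w2 holds on a dense set. *)
Lemma continuous_ae_unique (w1 w2 : pt R -> 'cV[R]_2) :
  {within D, continuous w1} -> {within D, continuous w2} ->
  ae_eq_on D w1 w2 -> forall y, D y -> w1 y = w2 y.
Proof.
move=> c1 c2 w12 y Dy.
have near_w (w : pt R -> 'cV[R]_2) e : {within D, continuous w} -> 0 < e ->
    \forall x \near y, D x -> ball (w y) e (w x).
  move=> cw e0; have := cw y => /cvg_ballP/(_ _ e0).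
  have E := congr1 (fun f : set_system (pt R) => f (fun x => ball (w y) e (w x)))
    (nbhs_subspace_in Dy).
  by move=> h; change (within D (nbhs y) (fun x => ball (w y) e (w x))); rewrite E.
apply: contrapT => neq.
(* At a nearby point where w1 = w2, both values at y are within e, which would make them strictly
   closer than 2 e. *)
pose e := `|w1 y - w2 y| / 2.
have e0 : 0 < e by rewrite divr_gt0// normr_gt0 subr_eq0; apply/eqP.
have := filterI (near_w w1 e c1 e0) (near_w w2 e c2 e0).
move=> /(_ _)/nbhs_ballP[d /= d0 H].
have [z [r [r0 rD ry]]] := element_interior_dense Dy d0.
have [x zx wx] := ae_ball z r0 w12.
have [] := H _ (ry _ zx); move=> /(_ (rD _ zx)) + /(_ (rD _ zx)).
rewrite -!ball_normE/= wx; last exact: rD.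
rewrite (distrC (w2 y)) => h1 h2.
have := ler_distD (w2 x) (w1 y) (w2 y).
rewrite leNgt => /negP; apply; rewrite (lt_le_trans (ltrD h1 h2))//.
by rewrite /e -splitr.
Qed.

End Element.

(** * Unisolvence of the nodal values *)

Section Unisolvence.
Context {R : realType}.

Lemma ae_eq_on_sym (D : set (pt R)) (v w : pt R -> 'cV[R]_2) :
  ae_eq_on D v w -> ae_eq_on D w v.
Proof. by apply: negligibleS => x /= h1 h2; apply: h1 => Dx; rewrite h2. Qed.

Lemma ae_eq_on_trans (D : set (pt R)) (u v w : pt R -> 'cV[R]_2) :
  ae_eq_on D u v -> ae_eq_on D v w -> ae_eq_on D u w.
Proof.
move=> uv vw; apply: negligibleS (negligibleU uv vw) => x /= bad.
apply: contrapT => /not_orP[/contrapT h1 /contrapT h2]; apply: bad => Dx.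
by rewrite h1// h2.
Qed.

Lemma quadratic_id : quadratic_map (fun x : pt R => x).
Proof.
move=> i; apply/Pk2E; rewrite /coor; case: (i == 0).
  by exists ((0, 1, 0), (0, 0, 0)) => x /=; ring.
by exists ((0, 0, 1), (0, 0, 0)) => x /=; ring.
Qed.

Lemma Vhat_ivec (val : pt R -> 'cV[R]_2) : Vhat (ivec val).
Proof.
split=> [i|K /ct_splitE[k ->] i]; last first.
  have [p p2 pE] := sint_local k (fun a => val a i 0).
  by exists p => // x /interior_subset kx; rewrite mxE pE.
rewrite (_ : (fun x => _) = sint (fun a => val a i 0)); last first.
  by apply/funext => x; rewrite mxE.
apply: loclip_H1; first exact: compact_ref_triangle.
  by move=> z _; exact: loclip_sint.
(* The skeleton of the reference triangle itself is the case F = id. *)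
apply: negligibleS (negligible_skeleton quadratic_id) => x /= bad.
exists x => //; split.
  by apply: contrapT => nT; apply: bad => /interior_subset.
move=> k kx; apply: bad => _ j.
have [p p2 pE] := sint_local k (fun a => val a i 0).
have [p' _ dp] := smooth_derive (edir j) (Pk_smooth p2).
apply: (near_eq_derivable (f := p)); last by have [] := dp x.
by apply: filterS (near_cell kx) => y /cellW /pE ->.
Qed.

Variables (M : iso_mesh R) (T : elt M) (G : pt R -> pt R) (U : set (pt R)).
Let F := Fmap T.
Hypotheses (GF : forall x, ref_triangle x -> G (F x) = x)
  (oU : open U) (DU : element T `<=` U)
  (CG : forall i, Ck 1 U (fun x => coor i (G x))).

Let qF : quadratic_map F := Fmap_quadratic T.

Let detF x : ref_triangle x -> \det (jac F x) != 0.
Proof.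
move=> Tx; have /andP[h _] := Fmap_det T Tx.
rewrite gt_eqF//; apply: lt_le_trans h.
by rewrite mulr_gt0 ?c1_gt0// exprn_gt0// hsize_gt0.
Qed.

Lemma VT_push val : VT T (push F G val).
Proof.
split; first exact: (H1_push qF detF GF oU DU CG).
exists (ivec val); first exact: Vhat_ivec.
by apply: aeW => y _ x Tx ->; rewrite /push GF.
Qed.

(** Two null sets are discarded: the one where the Piola identity fails, and the image of the
    skeleton, on which the reference function is unknown. *)
Lemma VT_representation v : VT T v ->
  exists val, ae_eq_on (element T) v (push F G val).
Proof.
move=> [_ [vh Hvh aev]].
have [val valE] := Vhat_representation Hvh.
exists val; apply: negligibleS (negligibleU aev (ae_cell qF GF)) => y /= bad.
apply: contrapT => /not_orP[/contrapT vE /contrapT ce]; apply: bad => Dy.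
have [k kGy] := ce Dy.
have [x Tx xE] := Dy.
have Gx : G y = x by rewrite -xE GF.
by rewrite (vE Dy x Tx (esym xE)) /push Gx -(valE k)// -Gx.
Qed.

(** [push] is one continuous representative, and by [continuous_ae_unique] any other agrees with it
    at every point of the element; so the relation becomes an equation. *)
Lemma value_at_push v val y (w : 'cV[R]_2) : ae_eq_on (element T) v (push F G val) ->
  element T y -> value_at (element T) v y w <-> w = push F G val y.
Proof.
move=> vE Dy; have cp := continuous_push qF detF GF oU DU CG.
split=> [[w' [cw' vw' <-]]|->]; last by exists (push F G val).
apply: (continuous_ae_unique qF detF GF oU DU CG) => //.
exact: ae_eq_on_trans (ae_eq_on_sym vw') vE.
Qed.

Lemma piola_unit x : ref_triangle x -> piola F x \in unitmx.
Proof.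
move=> Tx; have d0 := detF Tx.
by rewrite /piola unitmxZ ?unitfE ?invr_neq0// unitmxE unitfE.
Qed.

End Unisolvence.

(** The first clause turns nodal evaluation into a function on classes; the other two are its
    injectivity, modulo null sets, and its surjectivity. *)
Theorem lemma3p3 (R : realType) (M : iso_mesh R) (T : elt M) :
  [/\ (forall (v : pt R -> 'cV[R]_2) (a : pt R), VT T v -> nodes T a ->
         exists! y : 'cV[R]_2, value_at (element T) v a y),
      (forall v1 v2 : pt R -> 'cV[R]_2, VT T v1 -> VT T v2 ->
         (forall a : pt R, nodes T a ->
            exists2 y : 'cV[R]_2,
              value_at (element T) v1 a y & value_at (element T) v2 a y) ->
         ae_eq_on (element T) v1 v2) &
      (forall beta : pt R -> 'cV[R]_2,
         exists2 v : pt R -> 'cV[R]_2,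
           VT T v & forall a : pt R, nodes T a ->
             value_at (element T) v a (beta a))].
Proof.
have [_ [G [GF [U [oU DU CG]]]]] := Fmap_diffeo T.
have node_elt a : nodes T a -> element T a.
  by move=> [x /ref_nodes_triangle Tx <-]; exists x.
have valP := value_at_push GF oU DU CG.
have pushF (val : pt R -> 'cV[R]_2) x : ref_nodes x ->
    push (Fmap T) G val (Fmap T x) = piola (Fmap T) x *m val x.
  exact: push_node.
split.
- move=> v a Hv /node_elt Da.
  have [val vE] := VT_representation GF Hv.
  exists (push (Fmap T) G val a); split; first exact/(valP _ _ _ _ vE Da).
  by move=> y /(valP _ _ _ _ vE Da).
- move=> v1 v2 H1 H2 vals.
  have [val1 E1] := VT_representation GF H1.
  have [val2 E2] := VT_representation GF H2.
  have E : push (Fmap T) G val1 =1 push (Fmap T) G val2.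
    apply: push_ext => x nx.
    have nFx : nodes T (Fmap T x) by exists x.
    have [y /(valP _ _ _ _ E1 (node_elt _ nFx)) -> /(valP _ _ _ _ E2 (node_elt _ nFx))] := vals _ nFx.
    rewrite !pushF// => /(congr1 (mulmx (invmx (piola (Fmap T) x)))).
    by rewrite !mulKmx// piola_unit//; exact: ref_nodes_triangle.
  by apply: ae_eq_on_trans E1 (ae_eq_on_sym _); rewrite (funext E).
- move=> beta.
  (* The reference data whose Piola image at each node is the prescribed value. *)
  pose val x := invmx (piola (Fmap T) x) *m beta (Fmap T x).
  exists (push (Fmap T) G val); first exact: (VT_push GF oU DU CG).
  move=> a /[dup] /node_elt Da [x nx xa].
  have refl : ae_eq_on (element T) (push (Fmap T) G val) (push (Fmap T) G val).
    exact: aeW.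
  apply/(valP _ _ _ _ refl Da).
  by rewrite -xa pushF// mulKVmx// piola_unit//; exact: ref_nodes_triangle.
Qed.
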